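(* Let $(X_n)_{n\ge 1}$ be i.i.d. random variables with $\mathbb{P}(X_1=1)=\mathbb{P}(X_1=-1)=1/2$, and for $\sigma>1/2$ let $F(\sigma)=\sum_{n=1}^\infty \frac{X_n}{n^\sigma}$. Then, almost surely, $$\limsup_{\sigma\to 1/2^+}\frac{F(\sigma)}{\sqrt{2\,\mathbb{E}[F(\sigma)^2]\,\log\log \mathbb{E}[F(\sigma)^2]}}=1.$$
   Context: Almost surely the series defining $F(\sigma)$ converges for every $\sigma>1/2$ (simultaneously) and defines a function of $\sigma$ that extends analytically to the half plane $\mathrm{Re}(s)>1/2$; the $\limsup$ is over the continuous real parameter $\sigma\to 1/2^+$. $\mathbb{E}[F(\sigma)^2]=\sum_{n\ge1} n^{-2\sigma}$ is a deterministic function of $\sigma$ that tends to $+\infty$ as $\sigma\to1/2^+$, so the iterated logarithm is defined and positive for $\sigma$ close to $1/2$. *)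

(* Defs.v *)
From HB Require Import structures.
From mathcomp Require Import all_boot all_order all_algebra.
From mathcomp Require Import all_classical all_reals all_analysis.

Set Implicit Arguments.
Unset Strict Implicit.
Unset Printing Implicit Defensive.

Import Order.TTheory GRing.Theory Num.Theory.
Import numFieldNormedType.Exports.

Local Open Scope classical_set_scope.
Local Open Scope ring_scope.

(* Taking Borel sets over all finite index families is the usual independence
   of an infinite family of random variables. *)
Definition mutually_independent (R : realType) (d : measure_display)
    (T : measurableType d) (P : probability T R) (X : nat -> {RV P >-> R}) :=
  forall (s : seq nat) (A : nat -> set R),
    uniq s -> (forall i, measurable (A i)) ->
    P (\bigcap_(i in [set` s]) (X i @^-1` A i)) =
      (\prod_(i <- s) P (X i @^-1` A i))%E.

Definition identically_distributed (R : realType) (d : measure_display)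
    (T : measurableType d) (P : probability T R) (X : nat -> {RV P >-> R}) :=
  forall (m n : nat) (A : set R),
    measurable A -> distribution P (X m) A = distribution P (X n) A.

Definition iid (R : realType) (d : measure_display) (T : measurableType d)
    (P : probability T R) (X : nat -> {RV P >-> R}) :=
  mutually_independent X /\ identically_distributed X.

(* The index is shifted by one: [X n] is the coefficient of (n+1)^(- sigma).
   The sum is the limit of the partial sums in their natural order; it has an
   unspecified value at the points where they diverge. *)
Definition random_dirichlet (R : realType) (d : measure_display)
    (T : measurableType d) (P : probability T R) (X : nat -> {RV P >-> R})
    (sigma : R) (w : T) : R :=
  limn (series (fun n => X n w / n.+1%:R `^ sigma)).

Definition second_moment (R : realType) (d : measure_display)
    (T : measurableType d) (P : probability T R) (X : nat -> {RV P >-> R})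
    (sigma : R) : R :=
  fine ('E_P[fun w => (random_dirichlet X sigma w ^+ 2)%R])%E.

(* Main.v *)
Require Import Defs.
From HB Require Import structures.
From mathcomp Require Import all_boot all_order all_algebra.
From mathcomp Require Import all_classical all_reals all_analysis.
From mathcomp Require Import measurable_realfun ring lra.
Import Order.TTheory GRing.Theory Num.Theory.
Import numFieldNormedType.Exports.

Local Open Scope classical_set_scope.
Local Open Scope ring_scope.

(** The proof writes u = sigma - 1/2 and S_n for the partial sums of the signs
weighted by n^(-1/2), and compares the normalization with
psi(log(1/u)) = sqrt(log log (1/u) / u), using E F^2 = 1/(2u) + O(1).

Every probability estimate is an average over finite sign sequences.  The
elementary bound cosh x <= exp(x^2/2) gives, by induction on the length, the
maximal inequality P(exists n, sum_{i<n} (a_i X_i - a_i^2/2) >= t) <= exp(-t).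
With a single multiplier per scale u = exp(-k c) and Borel-Cantelli, it yields
both |S_n| <= 3 psi n^(u/4) for all n, and the sharp upper bound for F along the
scales.  Summation by parts turns the growth bound on S_n into the convergence
of the series, the oscillation bound |F(u) - F(v)| <= C psi (v - u)/u that fills
the gaps between scales, and the smallness of the head and the tail of the
series.

For the lower bound, take the scales u = q^(-k-1) with q large: up to a small
multiple of psi, F is then the sum over the block 2^(L q^k) <= i < 2^(L q^(k+1)).
These blocks are disjoint, a Gaussian lower tail for weighted sign sums follows
from upper and lower bounds on the exponential moments, and the second
Borel-Cantelli lemma applies. *)

(** * Sums of powers and the hyperbolic cosine *)

(** At u = exp(-y) the value psi y is exceeded with probability about 1/y, and along the scales y
    runs through the multiples of a constant c. The two Borel-Cantelli lemmas therefore meet exactly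
    at the constant 1: a factor 1 + e in the exponent makes the probabilities summable, a factor
    below 1 makes them diverge. Since u is continuous and the series infinite, a tail bound at fixed
    u and n does not suffice. The compensator a_i^2/2 gives one bound for all n at once; its price
    is the factor n^(u/4), which n^(-u) still absorbs. Passing to the limit in n and to other u is
    then deterministic. For the lower bound, the values of F at different scales are dependent,
    which the second Borel-Cantelli lemma does not allow. The k-th block is the range where u log n
    runs from (L/q) log 2 to L log 2. Before it the partial sums obey the growth bound of the
    preceding scale, whose psi is smaller by a factor sqrt q; after it n^(-u) has decayed. So L is
    chosen large first, and q large depending on L. *)

(* The power (i+1)^(-s): indices are shifted by one, as in the definition of the
   random Dirichlet series. *)
Definition npow {R : realType} (s : R) (i : nat) : R := expR (- s * ln i.+1%:R).

Section npow_theory.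
Context {R : realType}.
Implicit Types (s u v : R) (i m n : nat).

Lemma npow_ge0 s i : 0 <= npow s i.
Proof. exact: expR_ge0. Qed.

Lemma ln_succ_ge0 i : 0 <= ln i.+1%:R :> R.
Proof. by apply: ln_ge0; rewrite ler1n. Qed.

Lemma npowD u v i : npow (u + v) i = npow u i * npow v i.
Proof. by rewrite /npow -expRD; congr expR; ring. Qed.

Lemma npow1 i : npow 1 i = (i.+1%:R)^-1 :> R.
Proof. by rewrite /npow mulN1r expRN lnK // posrE ltr0n. Qed.

Lemma npow_powR s i : npow s i = (i.+1%:R `^ s)^-1.
Proof. by rewrite /npow /powR pnatr_eq0 /= mulNr expRN. Qed.

Lemma npow_at0 s : npow s 0 = 1.
Proof. by rewrite /npow ln1 mulr0 expR0. Qed.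

Lemma npow_le1 s i : 0 <= s -> npow s i <= 1.
Proof.
by move=> s0; rewrite /npow -[leRHS]expR0 ler_expR mulNr oppr_le0 mulr_ge0 ?ln_succ_ge0.
Qed.

Lemma npow_anti s m n : 0 <= s -> (m <= n)%N -> npow s n <= npow s m.
Proof.
move=> s0 mn; rewrite /npow ler_expR !mulNr lerN2 ler_wpM2l //.
by rewrite ler_ln ?posrE ?ltr0n // ler_nat.
Qed.

Lemma npow_le u v i : u <= v -> npow v i <= npow u i.
Proof. by move=> uv; rewrite /npow ler_expR !mulNr lerN2 ler_wpM2r // ln_succ_ge0. Qed.

Lemma ln_succ_ub i : ln i.+2%:R - ln i.+1%:R <= (i.+1%:R)^-1 :> R.
Proof.
rewrite -ln_div ?posrE ?ltr0n //.
have -> : i.+2%:R / i.+1%:R = 1 + (i.+1%:R)^-1 :> R.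
  by rewrite -[in i.+2](addn1 i.+1) natrD mulrDl divff ?pnatr_eq0 // mul1r.
apply: le_ln1Dx; apply: (@lt_trans _ _ 0); first by rewrite oppr_lt0.
by rewrite invr_gt0 ltr0n.
Qed.

Lemma ln_succ_lb i : (i.+2%:R)^-1 <= ln i.+2%:R - ln i.+1%:R :> R.
Proof.
rewrite -[leRHS]opprB lerNr -ln_div ?posrE ?ltr0n //.
have -> : i.+1%:R / i.+2%:R = 1 + - (i.+2%:R)^-1 :> R.
  have : i.+2%:R != 0 :> R by rewrite pnatr_eq0.
  rewrite -[in i.+2](addn1 i.+1) natrD => h; by field.
apply: le_ln1Dx; rewrite ltrN2 invf_lt1 ?ltr0n // ltr1n //.
Qed.

Lemma ln_succ_diff_ge0 i : 0 <= ln i.+2%:R - ln i.+1%:R :> R.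
Proof. by apply: le_trans (ln_succ_lb i); rewrite invr_ge0. Qed.

Lemma npow_succ s i :
  npow s i.+1 = npow s i * expR (- (s * (ln i.+2%:R - ln i.+1%:R))).
Proof. by rewrite /npow -expRD; congr expR; ring. Qed.

Lemma one_sub_expRN (x : R) : 1 - expR (- x) <= x.
Proof. by have := expR_ge1Dx (- x); lra. Qed.

(** Discrete form of the derivative of x^(-s). With the matching lower bound below, sums of
    [npow (1 + s)] are compared with telescoping sums instead of integrals. *)
Lemma npow_diff_ub s i : 0 <= s -> npow s i - npow s i.+1 <= s * npow (1 + s) i.
Proof.
move=> s0; rewrite npow_succ -{1}[npow s i]mulr1 -mulrBr npowD npow1.
rewrite mulrCA mulrA mulrC ler_wpM2r ?npow_ge0 //.
apply: le_trans (one_sub_expRN _) _.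
by rewrite [leRHS]mulrC ler_wpM2l // ln_succ_ub.
Qed.

Lemma npow_diff_lb s i : 0 <= s -> s * npow (1 + s) i.+1 <= npow s i - npow s i.+1.
Proof.
move=> s0.
have -> : npow s i = npow s i.+1 * expR (s * (ln i.+2%:R - ln i.+1%:R)).
  by rewrite /npow -expRD; congr expR; ring.
rewrite -[X in _ - X]mulr1 -mulrBr npowD npow1.
rewrite mulrCA mulrA mulrC ler_wpM2l ?npow_ge0 //.
have := expR_ge1Dx (s * (ln i.+2%:R - ln i.+1%:R) : R).
have : s * (i.+2%:R)^-1 <= s * (ln i.+2%:R - ln i.+1%:R) by rewrite ler_wpM2l // ln_succ_lb.
rewrite [X in X <= _ - 1]mulrC lerBrDl => h1 h2.
by apply: le_trans h2; rewrite lerD2l.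
Qed.

Lemma sum_npow_lb s m n : 0 <= s -> (m <= n)%N ->
  npow s m - npow s n <= s * \sum_(m <= i < n) npow (1 + s) i.
Proof.
move=> s0 mn.
rewrite -opprB -telescope_sumr // -sumrN mulr_sumr ler_sum // => i _.
by rewrite opprB npow_diff_ub.
Qed.

Lemma sum_npow_ub s m n : 0 < s ->
  \sum_(m.+1 <= i < n) npow (1 + s) i <= npow s m / s.
Proof.
move=> s0; have [mn|nm] := ltnP m n; last first.
  by rewrite big_geq ?(leq_trans nm) // divr_ge0 ?npow_ge0 // ltW.
rewrite ler_pdivlMr // mulrC mulr_sumr.
have : \sum_(m.+1 <= i < n) s * npow (1 + s) i <=
       \sum_(m.+1 <= i < n) - (npow s i - npow s i.-1).
  rewrite !big_nat; apply: ler_sum => -[//|i] _.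
  by rewrite opprB npow_diff_lb // ltW.
move=> h; apply: le_trans h _.
case: n mn => // n mn; rewrite big_add1 /= sumrN telescope_sumr // opprB.
by rewrite gerBl npow_ge0.
Qed.

Lemma sum_npow_le s n : 0 < s -> \sum_(0 <= i < n) npow (1 + s) i <= 1 + s^-1.
Proof.
move=> s0; case: n => [|n]; first by rewrite big_geq // addr_ge0 // invr_ge0 ltW.
rewrite big_nat_recl // npow_at0 lerD2l -(big_add1 _ _ 0 n.+1 xpredT (npow (1 + s))).
by apply: le_trans (sum_npow_ub _ _ _ s0) _; rewrite npow_at0 div1r.
Qed.

Lemma sum_npow1_le n : \sum_(0 <= i < n.+1) npow 1 i <= 1 + ln n.+1%:R :> R.
Proof.
elim: n => [|n IH]; first by rewrite big_nat1 npow_at0 ln1 addr0.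
rewrite big_nat_recr //=.
by have := ln_succ_lb n; rewrite -npow1; lra.
Qed.

End npow_theory.


(** * Gaussian bounds for the hyperbolic cosine *)

Section cosh_bounds.
Context {R : realType}.
Implicit Types x y : R.

Definition hcosh x : R := (expR x + expR (- x)) / 2.

(** Partial sums of even length of the exponential series at x and at -x are averaged, so that the
    odd terms cancel. *)
Lemma hcosh_series x :
  series (fun k => x ^+ k.*2 / (k.*2)`!%:R) @ \oo --> hcosh x.
Proof.
have cx : series (exp_coeff x) @ \oo --> expR x.
  exact: is_cvg_series_exp_coeff.
have cy : series (exp_coeff (- x)) @ \oo --> expR (- x).
  exact: is_cvg_series_exp_coeff.
have c : (fun n => (series (exp_coeff x) n.*2 + series (exp_coeff (- x)) n.*2) / 2)
    @ \oo --> hcosh x.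
  have d : (fun n => n.*2) @ \oo --> \oo.
    apply/cvgnyPge => A; near=> n; apply: (@leq_trans n).
      by near: n; exact: nbhs_infty_ge.
    by rewrite -addnn leq_addr.
  apply: cvgMl; apply: cvgD; [exact: (cvg_comp _ _ d cx) | exact: (cvg_comp _ _ d cy)].
move: c; apply: cvg_trans; apply: near_eq_cvg; near=> n.
rewrite /series /= -big_split /=.
elim: (n) => [|m IH]; first by rewrite !big_geq // mul0r.
rewrite doubleS !big_nat_recr //= -addrA mulrDl IH; congr (_ + _).
have e2 : (- x) ^+ m.*2 = x ^+ m.*2 by rewrite -mul2n !exprM sqrrN.
have ec z k : exp_coeff z k = z ^+ k / k`!%:R :> R by rewrite exp_coeffE mulrC.
rewrite !ec !(exprS _ m.*2) e2 !mulNr subrr addr0.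
by rewrite -mulr2n -[_ *+ 2]mulr_natr mulfK // pnatr_eq0.
Unshelve. all: by end_near.
Qed.

Lemma fact_double_ge k : (2 ^ k * k`! <= (k.*2)`!)%N.
Proof.
elim: k => // k IH; rewrite doubleS !factS expnS.
rewrite (_ : (2 * 2 ^ k * (k.+1 * k`!) = 2 * k.+1 * (2 ^ k * k`!))%N); last by ring.
apply: leq_mul; first by rewrite mul2n doubleS.
by apply: leq_trans IH _; exact: leq_pmull.
Qed.

(** Term by term, x^(2k)/(2k)! <= (x^2/2)^k/k! by [fact_double_ge]. *)
Lemma hcosh_le x : hcosh x <= expR (x ^+ 2 / 2).
Proof.
have c1 : series (exp_coeff (x ^+ 2 / 2)) @ \oo --> expR (x ^+ 2 / 2).
  exact: is_cvg_series_exp_coeff.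
apply: (ler_cvg_to (@hcosh_series x) c1).
near=> n; rewrite /series /=; apply: ler_sum => k _.
rewrite /exp_coeff /= expr_div_n -exprM mul2n -mulrA ler_wpM2l //.
  by rewrite -muln2 exprM sqr_ge0.
rewrite -invfM lef_pV2 ?posrE ?mulr_gt0 ?exprn_gt0 ?ltr0n ?fact_gt0 //.
by rewrite -natrX -natrM ler_nat fact_double_ge.
Unshelve. all: by end_near.
Qed.

Lemma hcosh_ge x : 1 + x ^+ 2 / 2 <= hcosh x.
Proof.
rewrite -(cvg_lim _ (@hcosh_series x)) //.
apply: limr_ge; first by apply/cvg_ex; eexists; exact: hcosh_series.
near=> n; have n2 : (2 <= n)%N by near: n; exact: nbhs_infty_ge.
rewrite /series /= (@big_cat_nat _ _ _ 2) //= big_nat_recr //= big_nat1 /=.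
rewrite expr0 fact0 divr1 lerDl sumr_ge0 // => k _.
by rewrite mulr_ge0 ?invr_ge0 // -muln2 exprM sqr_ge0.
Unshelve. all: by end_near.
Qed.

Lemma hcosh_ge_exp x : expR (x ^+ 2 / 2 - x ^+ 4 / 4) <= hcosh x.
Proof.
apply: le_trans (hcosh_ge x).
(* The chain is exp(y - y^2) <= 1/(1 - y + y^2) <= 1 + y, where the last step holds because (1 +
   y)(1 - y + y^2) = 1 + y^3. *)
set y := x ^+ 2 / 2; have -> : x ^+ 4 / 4 = y ^+ 2 by rewrite /y; field.
have y0 : 0 <= y by rewrite divr_ge0 // sqr_ge0.
rewrite -[_ - _]opprK expRN -[leRHS]invrK lef_pV2 ?posrE ?expR_gt0 ?invr_gt0 //; last by lra.
apply: le_trans (expR_ge1Dx _).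
rewrite -[leLHS]div1r ler_pdivrMr; last by lra.
have : 0 <= y ^+ 3 by rewrite exprn_ge0.
nra.
Qed.

End cosh_bounds.

(** * Summation by parts *)

Section abel.
Context {R : realType}.
Implicit Types (S D : nat -> R) (u v B C : R) (m n : nat).

Lemma abel_sum S D m n : (m <= n)%N ->
  \sum_(m <= i < n) (S i.+1 - S i) * D i =
  S n * D n - S m * D m + \sum_(m <= i < n) S i.+1 * (D i - D i.+1).
Proof.
move=> mn; rewrite -(telescope_sumr (fun i => S i * D i) mn) -big_split /=; apply: eq_bigr => i _.
by ring.
Qed.

(** Trades a logarithmic factor 1 + z, with z = u log i, for a quarter of the decay i^(-u). *)
Lemma one_add_le4 (z : R) : 0 <= z -> 1 + z <= 4 * expR (z / 4).
Proof. by move=> z0; have := expR_ge1Dx (z / 4); lra. Qed.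

Section growth.
Variables (S : nat -> R) (B u : R).
Hypothesis u0 : 0 < u.
Hypothesis SB : forall n, `|S n.+1| <= B * npow (- (u / 4)) n.

Lemma growth_ge0 : 0 <= B.
Proof. by have := SB 0; rewrite npow_at0 mulr1; apply: le_trans. Qed.

(** The weight i^(-u) absorbs the growth i^(u/4) and leaves decay with exponent 3u/4. The two
    boundary terms cost B each and the sum costs 4B/3, within the constant 4. *)
Lemma abel_tail m n : (m.+1 <= n)%N ->
  `|\sum_(m.+1 <= i < n) (S i.+1 - S i) * npow u i| <= 4 * B * npow (3 / 4 * u) m.
Proof.
move=> mn; have B0 := growth_ge0; rewrite abel_sum //.
have bd i : `|S i.+1 * npow u i| <= B * npow (3 / 4 * u) i.
  rewrite normrM (ger0_norm (npow_ge0 _ _)).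
  have -> : 3 / 4 * u = - (u / 4) + u by field.
  by rewrite npowD mulrA ler_wpM2r ?npow_ge0.
have bd' i : (m <= i)%N -> `|S i.+1 * npow u i.+1| <= B * npow (3 / 4 * u) m.
  move=> mi; apply: (@le_trans _ _ (B * npow (3 / 4 * u) i)).
    apply: le_trans (bd i); rewrite !normrM ler_wpM2l // !ger0_norm ?npow_ge0 //.
    by rewrite npow_anti // ltW.
  by rewrite ler_wpM2l // npow_anti // mulr_ge0 // ltW.
have h1 : `|S n * npow u n| <= B * npow (3 / 4 * u) m.
  by case: n mn => // n mn; apply: bd'.
have h2 := bd' _ (leqnn m).
have h3 : `|\sum_(m.+1 <= i < n) S i.+1 * (npow u i - npow u i.+1)| <=
     B * (4 / 3 * npow (3 / 4 * u) m).
  apply: le_trans (ler_norm_sum _ _ _) _.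
  apply: (@le_trans _ _ (\sum_(m.+1 <= i < n) (B * u) * npow (1 + 3 / 4 * u) i)).
    apply: ler_sum => i _; rewrite normrM [X in _ * X]ger0_norm; last first.
      by rewrite subr_ge0 npow_anti // ltW.
    apply: (@le_trans _ _ (B * npow (- (u / 4)) i * (u * npow (1 + u) i))).
      apply: ler_pM => //; first by rewrite subr_ge0 npow_anti // ltW.
      by rewrite npow_diff_ub // ltW.
    have -> : 1 + 3 / 4 * u = - (u / 4) + (1 + u) by field.
    by rewrite [npow (- (u / 4) + _) _]npowD le_eqVlt; apply/orP; left; apply/eqP; ring.
  rewrite -mulr_sumr -mulrA ler_wpM2l //.
  have s0 : 0 < 3 / 4 * u by rewrite mulr_gt0 // divr_gt0.
  apply: (@le_trans _ _ (u * (npow (3 / 4 * u) m / (3 / 4 * u)))).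
    by rewrite ler_wpM2l ?(ltW u0) // sum_npow_ub.
  by rewrite le_eqVlt; apply/orP; left; apply/eqP; field; rewrite gt_eqF.
have N0 : 0 <= B * npow (3 / 4 * u) m by rewrite mulr_ge0 ?npow_ge0.
apply: le_trans (ler_normD _ _) _.
have := ler_normB (S n * npow u n) (S m.+1 * npow u m.+1).
lra.
Qed.

(** A mixed difference, in the exponent and in the index: the first yields the factor v - u, the
    second the factor 1/i. The remaining factor 1 + u log i is absorbed by [one_add_le4], which
    gives the constant 4 and the exponent 3u/4. *)
Lemma npow_diff2 v i : u <= v ->
  `|(npow u i - npow v i) - (npow u i.+1 - npow v i.+1)| <=
  4 * (v - u) * npow (1 + 3 / 4 * u) i.
Proof.
move=> uv; set y : R := ln i.+1%:R; set h : R := ln i.+2%:R - ln i.+1%:R.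
have y0 : 0 <= y by exact: ln_succ_ge0.
have h0 : 0 <= h by exact: ln_succ_diff_ge0.
have hu : h <= npow 1 i by rewrite npow1; exact: ln_succ_ub.
rewrite !npow_succ -/h.
have e1 : npow u i - npow v i <= npow u i * ((v - u) * y).
  have -> : npow v i = npow u i * expR (- ((v - u) * y)).
    by rewrite /npow -/y -expRD; congr expR; ring.
  by rewrite -{1}[npow u i]mulr1 -mulrBr ler_wpM2l ?npow_ge0 // one_sub_expRN.
have e0 : 0 <= npow u i - npow v i by rewrite subr_ge0 npow_le.
have e2 : expR (- (u * h)) - expR (- (v * h)) <= (v - u) * h.
  have -> : expR (- (v * h)) = expR (- (u * h)) * expR (- ((v - u) * h)).
    by rewrite -expRD; congr expR; ring.
  rewrite -{1}[expR (- (u * h))]mulr1 -mulrBr.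
  have a1 : expR (- (u * h)) <= 1 by rewrite expR_le1 oppr_le0 mulr_ge0 // ltW.
  have a2 : 0 <= 1 - expR (- ((v - u) * h)).
    by rewrite subr_ge0 expR_le1 oppr_le0 mulr_ge0 // subr_ge0.
  apply: le_trans (one_sub_expRN _).
  by rewrite -[leRHS]mul1r ler_wpM2r.
have e3 : 0 <= expR (- (u * h)) - expR (- (v * h)).
  by rewrite subr_ge0 ler_expR lerN2 ler_wpM2r.
have e4 : 0 <= 1 - expR (- (u * h)).
  by rewrite subr_ge0 expR_le1 oppr_le0 mulr_ge0 // ltW.
have e5 := one_sub_expRN (u * h).
have vu : npow v i <= npow u i by exact: npow_le.
have -> : npow u i - npow v i - (npow u i * expR (- (u * h)) - npow v i * expR (- (v * h))) =
  (npow u i - npow v i) * (1 - expR (- (u * h))) -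
   npow v i * (expR (- (u * h)) - expR (- (v * h))) by ring.
apply: le_trans (ler_normB _ _) _.
rewrite !ger0_norm ?mulr_ge0 ?npow_ge0 //.
apply: (@le_trans _ _ (npow u i * ((v - u) * y) * (u * h) + npow u i * ((v - u) * h))).
  by apply: lerD; apply: ler_pM; rewrite ?npow_ge0.
have -> : npow u i * ((v - u) * y) * (u * h) + npow u i * ((v - u) * h) =
  (v - u) * (npow u i * (1 + u * y) * h) by ring.
rewrite -[leRHS]mulrA [leRHS]mulrCA ler_wpM2l ?subr_ge0 //.
have -> : 4 * npow (1 + 3 / 4 * u) i = 4 * npow (3 / 4 * u) i * npow 1 i.
  by rewrite npowD; ring.
have uy0 : 0 <= u * y by rewrite mulr_ge0 // ltW.
apply: ler_pM => //; first by rewrite mulr_ge0 ?npow_ge0 ?addr_ge0.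
have -> : npow (3 / 4 * u) i = npow u i * expR (u * y / 4).
  by rewrite /npow -/y -expRD; congr expR; field.
by rewrite mulrCA ler_wpM2l ?npow_ge0 // one_add_le4.
Qed.

Hypothesis S0 : S 0 = 0.
Hypothesis u1 : u <= 1.

(** The growth of S and the logarithm of [npow_diff2] use u/4 of the decay each; the remaining u/2
    sums to at most 1 + 2/u <= 3/u. This gives 12 of the constant 16, and the boundary term gives
    4. *)
Lemma abel_osc v n : u <= v ->
  `|\sum_(0 <= i < n) (S i.+1 - S i) * (npow u i - npow v i)| <= 16 * B * ((v - u) / u).
Proof.
move=> uv; have B0 := growth_ge0.
have w0 : 0 <= (v - u) / u by rewrite divr_ge0 ?subr_ge0 // ltW.
case: n => [|n]; first by rewrite big_geq // normr0 mulr_ge0 // mulr_ge0.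
rewrite abel_sum // S0 mul0r subr0.
apply: le_trans (ler_normD _ _) _.
have -> : 16 * B * ((v - u) / u) = B * (4 * ((v - u) / u)) + 12 * B * ((v - u) / u) by ring.
apply: lerD.
  rewrite normrM [X in _ * X]ger0_norm ?subr_ge0 ?npow_le //.
  set y : R := ln n.+2%:R.
  have y0 : 0 <= y by exact: ln_succ_ge0.
  have e1 : npow u n.+1 - npow v n.+1 <= npow u n.+1 * ((v - u) * y).
    have -> : npow v n.+1 = npow u n.+1 * expR (- ((v - u) * y)).
      by rewrite /npow -/y -expRD; congr expR; ring.
    by rewrite -{1}[npow u _]mulr1 -mulrBr ler_wpM2l ?npow_ge0 // one_sub_expRN.
  have e2 : y <= 4 / u * expR (u * y / 4).
    rewrite mulrAC ler_pdivlMr //.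
    by have := expR_ge1Dx (u * y / 4); lra.
  have e3 : npow u n.+1 * ((v - u) * y) <= 4 * ((v - u) / u) * npow (u / 4) n.+1.
    apply: (@le_trans _ _ (npow u n.+1 * ((v - u) * (4 / u * expR (u * y / 4))))).
      by rewrite ler_wpM2l ?npow_ge0 // ler_wpM2l // subr_ge0.
    have -> : npow u n.+1 * ((v - u) * (4 / u * expR (u * y / 4))) =
        4 * ((v - u) / u) * (npow u n.+1 * expR (u * y / 4)) by ring.
    apply: ler_wpM2l; first exact: mulr_ge0.
    have uy0 : 0 <= u * y by rewrite mulr_ge0 // ltW.
    by rewrite /npow -/y -expRD ler_expR; lra.
  apply: (@le_trans _ _ (B * npow (- (u / 4)) n * (4 * ((v - u) / u) * npow (u / 4) n.+1))).
    apply: ler_pM => //; first by rewrite subr_ge0 npow_le.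
    exact: le_trans e1 e3.
  have -> : B * npow (- (u / 4)) n * (4 * ((v - u) / u) * npow (u / 4) n.+1) =
     B * (4 * ((v - u) / u)) * (npow (- (u / 4)) n * npow (u / 4) n.+1) by ring.
  rewrite -[leRHS]mulr1; apply: ler_wpM2l; first by rewrite mulr_ge0 // mulr_ge0.
  apply: (@le_trans _ _ (npow (- (u / 4)) n * npow (u / 4) n)).
    by rewrite ler_wpM2l ?npow_ge0 // npow_anti // divr_ge0 // ltW.
  by rewrite -npowD addNr /npow oppr0 mul0r expR0.
apply: le_trans (ler_norm_sum _ _ _) _.
apply: (@le_trans _ _ (\sum_(0 <= i < n.+1) (4 * B * (v - u)) * npow (1 + u / 2) i)).
  apply: ler_sum => i _; rewrite normrM.
  apply: (@le_trans _ _ (B * npow (- (u / 4)) i * (4 * (v - u) * npow (1 + 3 / 4 * u) i))).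
    by apply: ler_pM => //; exact: npow_diff2.
  have -> : 1 + u / 2 = - (u / 4) + (1 + 3 / 4 * u) by field.
  by rewrite [npow (- (u / 4) + _) _]npowD le_eqVlt; apply/orP; left; apply/eqP; ring.
rewrite -mulr_sumr.
have u2 : 0 < u / 2 by rewrite divr_gt0.
apply: (@le_trans _ _ (4 * B * (v - u) * (1 + (u / 2)^-1))).
  by rewrite ler_wpM2l ?mulr_ge0 ?subr_ge0 // sum_npow_le.
have -> : 12 * B * ((v - u) / u) = 4 * B * (v - u) * (3 / u) by ring.
rewrite ler_wpM2l ?mulr_ge0 ?subr_ge0 // invf_div -lerBrDr -mulrBl ler_pdivlMr // mul1r.
by apply: le_trans u1 _; rewrite (_ : 3 - 2 = 1 :> R) //; ring.
Qed.

End growth.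

(** Abel's inequality: the weights decrease from 1, so after summation by parts the coefficients of
    the S_j are nonnegative with total 1. *)
Lemma abel_init S C u n : 0 <= u -> S 0 = 0 -> (forall j, (j <= n)%N -> `|S j| <= C) ->
  `|\sum_(0 <= i < n) (S i.+1 - S i) * npow u i| <= C.
Proof.
move=> u0 S0 SC; have C0 : 0 <= C by exact: le_trans (SC 0 _).
rewrite abel_sum // S0 mul0r subr0.
apply: le_trans (ler_normD _ _) _.
have h1 : `|S n * npow u n| <= C * npow u n.
  by rewrite normrM [X in _ * X]ger0_norm ?npow_ge0 // ler_wpM2r ?npow_ge0 // SC.
have h2 : `|\sum_(0 <= i < n) S i.+1 * (npow u i - npow u i.+1)| <= C * (1 - npow u n).
  apply: le_trans (ler_norm_sum _ _ _) _.
  have -> : 1 - npow u n = \sum_(0 <= i < n) (npow u i - npow u i.+1).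
    by rewrite (telescope_sumr_eq (fun i => - npow u i)) // ?npow_at0 ?opprK 1?addrC // => i _; rewrite opprK addrC.
  rewrite mulr_sumr !big_nat; apply: ler_sum => i /andP[_ iN].
  have d0 : 0 <= npow u i - npow u i.+1 by rewrite subr_ge0 npow_anti.
  by rewrite normrM [X in _ * X]ger0_norm // ler_wpM2r // SC.
lra.
Qed.

End abel.

(** * Averages over sign sequences *)

(** Expectation over independent fair signs, as a recursion on the first sign: estimates become
    finite inductions, tied to the probability space only by [integral_cyl_signs]. *)
Fixpoint avg {R : realType} (n : nat) (f : seq bool -> R) : R :=
  if n is m.+1 then
    (avg m (fun s => f (true :: s)) + avg m (fun s => f (false :: s))) / 2
  else f [::].

Definition sgb {R : realType} (b : bool) : R := if b then 1 else -1.

Fixpoint wsum {R : realType} (a : nat -> R) (m : nat) (s : seq bool) : R :=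
  if s is b :: s' then a m * sgb b + wsum a m.+1 s' else 0.

(* Whether some partial sum of a_i s_i - a_i^2/2 reaches t: each step is subtracted
   from the threshold, so the test is t <= 0. *)
Fixpoint hit {R : realType} (a : nat -> R) (t : R) (m : nat) (s : seq bool) : bool :=
  (t <= 0) ||
  (if s is b :: s' then hit a (t - (a m * sgb b - a m ^+ 2 / 2)) m.+1 s' else false).

Section avg_theory.
Context {R : realType}.
Implicit Types (f g : seq bool -> R) (a : nat -> R) (m n : nat) (c t : R).

Lemma le_avg n f g : (forall s, size s = n -> f s <= g s) -> avg n f <= avg n g.
Proof.
elim: n f g => [|n IH] f g fg /=; first exact: fg.
rewrite ler_pM2r ?invr_gt0 // lerD //; apply: IH => s sn; apply: fg => /=; by rewrite sn.
Qed.

Lemma eq_avg n f g : (forall s, size s = n -> f s = g s) -> avg n f = avg n g.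
Proof.
by move=> fg; apply/eqP; rewrite eq_le !le_avg // => s /fg ->.
Qed.

Lemma avgD n f g : avg n (fun s => f s + g s) = avg n f + avg n g.
Proof. by elim: n f g => [|n IH] f g //=; rewrite !IH -mulrDl addrACA. Qed.

Lemma avgZ n c f : avg n (fun s => c * f s) = c * avg n f.
Proof. by elim: n f => [|n IH] f //=; rewrite !IH mulrA mulrDr. Qed.

Lemma avg_cst n c : avg n (fun=> c) = c.
Proof. by elim: n => [|n IH] //=; rewrite IH; lra. Qed.

Lemma avg_ge0 n f : (forall s, 0 <= f s) -> 0 <= avg n f.
Proof. by move=> f0; rewrite -(avg_cst n 0); apply: le_avg. Qed.

(** Independence of an initial segment and the rest of the sequence. *)
Lemma avg_cat m n f g :
  avg (m + n) (fun s => f (take m s) * g (drop m s)) = avg m f * avg n g.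
Proof.
elim: m f => [|m IH] f /=.
  by rewrite add0n -avgZ; apply: eq_avg => s _; rewrite take0 drop0.
by rewrite (IH (fun s => f (true :: s))) (IH (fun s => f (false :: s))) -mulrDl mulrAC.
Qed.

Lemma avg_exp_wsum c a m n :
  avg n (fun s => expR (c * wsum a m s)) = \prod_(m <= i < m + n) hcosh (c * a i).
Proof.
elim: n m => [|n IH] m; first by rewrite addn0 big_geq //= mulr0 expR0.
rewrite /= big_ltn; last by rewrite addnS ltnS leq_addr.
rewrite (addnS m n) -(addSn m n) -(IH m.+1) /sgb /hcosh mulrAC; congr (_ / _).
rewrite mulrDl -!avgZ; congr (_ + _);
  apply: eq_avg => s _; rewrite -expRD; congr expR; ring.
Qed.

(** The constant c makes the induction work: it takes up the sign just read. *)
Lemma avg_sq_wsum c a m n :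
  avg n (fun s => (c + wsum a m s) ^+ 2) = c ^+ 2 + \sum_(m <= i < m + n) a i ^+ 2.
Proof.
elim: n m c => [|n IH] m c; first by rewrite addn0 big_geq //= !addr0.
rewrite /= big_ltn; last by rewrite addnS ltnS leq_addr.
have e b : avg n (fun s => (c + (a m * sgb b + wsum a m.+1 s)) ^+ 2) =
   avg n (fun s => ((c + a m * sgb b) + wsum a m.+1 s) ^+ 2).
  by apply: eq_avg => s _; rewrite addrA.
rewrite (e true) (e false) !IH addnS addSn /sgb; lra.
Qed.

Lemma avg_exp_wsum_le c a m n :
  avg n (fun s => expR (c * wsum a m s)) <=
  expR (c ^+ 2 / 2 * \sum_(m <= i < m + n) a i ^+ 2).
Proof.
rewrite avg_exp_wsum mulr_sumr expR_sum; apply: ler_prod => i _.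
rewrite (le_trans (hcosh_le _)) ?andbT.
  by rewrite divr_ge0 // addr_ge0 // expR_ge0.
by rewrite ler_expR exprMn mulrAC.
Qed.

Lemma avg_exp_wsum_ge c a m n :
  expR (c ^+ 2 / 2 * \sum_(m <= i < m + n) a i ^+ 2
        - c ^+ 4 / 4 * \sum_(m <= i < m + n) a i ^+ 4) <=
  avg n (fun s => expR (c * wsum a m s)).
Proof.
rewrite avg_exp_wsum !mulr_sumr -sumrB expR_sum; apply: ler_prod => i _.
rewrite expR_ge0 /=; apply: le_trans (hcosh_ge_exp _).
by rewrite ler_expR !exprMn [c ^+ 2 / 2 * _]mulrAC [c ^+ 4 / 4 * _]mulrAC.
Qed.

(** The maximal inequality for the exponential supermartingale, by induction: reading one sign
    multiplies the bound by cosh(a_m) exp(-a_m^2/2) <= 1, and once the level is reached the bound is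
    at least 1. *)
Lemma avg_hit_le a t m n : avg n (fun s => (hit a t m s)%:R) <= expR (- t).
Proof.
elim: n m t => [|n IH] m t /=.
  case: (leP t 0) => t0 /=; rewrite ?expR_ge0 //.
  by rewrite -[leLHS]expR0 ler_expR oppr_ge0.
case: (leP t 0) => t0 /=.
  by rewrite !avg_cst mulrDl -splitr -[leLHS]expR0 ler_expR oppr_ge0.
rewrite ler_pdivrMr //; apply: (le_trans (lerD (IH _ _) (IH _ _))).
rewrite /sgb !opprD !opprK !expRD mulr1 mulrN1 -!mulrDr -mulrA ler_wpM2l ?expR_ge0 //.
have := hcosh_le (a m); rewrite /hcosh -mulrDl ler_pdivrMr // => h.
have e : expR (a m ^+ 2 / 2) * expR (- (a m ^+ 2 / 2)) = 1 by rewrite expRxMexpNx_1.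
have E0 := expR_ge0 (- (a m ^+ 2 / 2)).
have ee : a m * (a m / 2) = a m ^+ 2 / 2 by ring.
by have := ler_wpM2r E0 h; rewrite ee [X in _ <= X -> _]mulrAC e mul1r.
Qed.

(* For l = sqrt (x/v), all but an exponentially small part of E exp(l S) comes from
   S within dl l v of l v; the two other parts are bounded by the exponential moments
   at (1 - dl) l and (1 + dl) l. *)
Lemma lower_tail a m n (dl x : R) :
  let v := \sum_(m <= i < m + n) a i ^+ 2 in
  0 < dl < 1 -> 0 < x -> 0 < v -> (forall i, `|a i| <= 1) ->
  expR (- (x * (2^-1 + dl))) * (expR (- (x ^+ 2 / (4 * v))) - 2 * expR (- (dl ^+ 2 * x / 2))) <=
  avg n (fun s => ((1 - dl) * Num.sqrt (x * v) <= wsum a m s)%R%:R).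
Proof.
move=> v /andP[d0 d1] x0 v0 a1.
set l := Num.sqrt (x / v).
have xv0 : 0 < x / v by rewrite divr_gt0.
have l0 : 0 < l by rewrite sqrtr_gt0.
have l2 : l ^+ 2 = x / v by rewrite sqr_sqrtr // ltW.
have l2v : l ^+ 2 * v = x by rewrite l2 divfK // gt_eqF.
have lv : Num.sqrt (x * v) = l * v.
  have -> : x * v = (l * v) ^+ 2 by rewrite exprMn -[v ^+ 2]/(v * v) mulrA l2v.
  by rewrite sqrtr_sqr ger0_norm // mulr_ge0 // ltW.
rewrite lv.
set p := avg _ _.
have h1 : avg n (fun s => expR (l * wsum a m s)) <=
   expR (x * (1 + dl)) * p +
   (expR (dl * (1 - dl) * x) * avg n (fun s => expR ((1 - dl) * l * wsum a m s)) +
    expR (- (dl * (1 + dl) * x)) * avg n (fun s => expR ((1 + dl) * l * wsum a m s))).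
  rewrite /p -!avgZ -!avgD; apply: le_avg => s _.
  set W := wsum a m s.
  have p1 : 0 <= expR (dl * (1 - dl) * x) * expR ((1 - dl) * l * W).
    by rewrite mulr_ge0 ?expR_ge0.
  have p2 : 0 <= expR (- (dl * (1 + dl) * x)) * expR ((1 + dl) * l * W).
    by rewrite mulr_ge0 ?expR_ge0.
  case: (leP ((1 - dl) * (l * v)) W) => hW.
    rewrite mulr1; case: (leP W ((1 + dl) * (l * v))) => hW2.
      have : expR (l * W) <= expR (x * (1 + dl)).
        rewrite ler_expR -l2v.
        have -> : l ^+ 2 * v * (1 + dl) = l * ((1 + dl) * (l * v)) by ring.
        by rewrite ler_wpM2l // ltW.
      lra.
    have : expR (l * W) <= expR (- (dl * (1 + dl) * x)) * expR ((1 + dl) * l * W).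
      rewrite -expRD ler_expR -l2v.
      have : dl * l * ((1 + dl) * (l * v)) <= dl * l * W.
        by rewrite ler_wpM2l ?mulr_ge0 // ltW.
      lra.
    have := expR_ge0 (x * (1 + dl)); lra.
  have : expR (l * W) <= expR (dl * (1 - dl) * x) * expR ((1 - dl) * l * W).
    rewrite -expRD ler_expR -l2v.
    have : dl * l * W <= dl * l * ((1 - dl) * (l * v)).
      by rewrite ler_wpM2l ?mulr_ge0 // ltW.
    lra.
  rewrite mulr0; lra.
have h2 := avg_exp_wsum_le ((1 - dl) * l) a m n.
have h3 := avg_exp_wsum_le ((1 + dl) * l) a m n.
have h4 := avg_exp_wsum_ge l a m n.
rewrite -/v in h2 h3 h4.
have s4 : \sum_(m <= i < m + n) a i ^+ 4 <= v.
  apply: ler_sum => i _; rewrite (_ : 4 = 2 * 2)%N // exprM.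
  have := sqr_ge0 (a i); have : a i ^+ 2 <= 1.
    by rewrite -real_normK ?num_real // expr_le1.
  rewrite [X in _ -> _ -> X <= _](expr2 (a i ^+ 2)); nra.
have h5 : expR (x / 2) * expR (- (x ^+ 2 / (4 * v))) <=
    avg n (fun s => expR (l * wsum a m s)).
  apply: le_trans h4; rewrite -expRD ler_expR.
  have -> : l ^+ 2 / 2 * v = x / 2 by rewrite mulrAC l2v.
  rewrite lerD2l lerN2.
  have -> : x ^+ 2 / (4 * v) = l ^+ 4 / 4 * v.
    rewrite -l2v; field; by rewrite gt_eqF.
  by rewrite ler_wpM2l // divr_ge0 // exprn_ge0 // ltW.
(* Both outer ranges end with the exponent (1 - dl^2) x/2, since dl (1 - dl) + (1 - dl)^2/2 = (1 -
   dl^2)/2 = (1 + dl)^2/2 - dl (1 + dl). *)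
have h6 : expR (dl * (1 - dl) * x) * avg n (fun s => expR ((1 - dl) * l * wsum a m s)) <=
     expR (x / 2) * expR (- (dl ^+ 2 * x / 2)).
  apply: (@le_trans _ _ (expR (dl * (1 - dl) * x) * expR (((1 - dl) * l) ^+ 2 / 2 * v))).
    by rewrite ler_wpM2l // expR_ge0.
  rewrite -!expRD ler_expR.
  have -> : ((1 - dl) * l) ^+ 2 / 2 * v = (1 - dl) ^+ 2 / 2 * (l ^+ 2 * v) by ring.
  by rewrite l2v; lra.
have h7 : expR (- (dl * (1 + dl) * x)) * avg n (fun s => expR ((1 + dl) * l * wsum a m s)) <=
     expR (x / 2) * expR (- (dl ^+ 2 * x / 2)).
  apply: (@le_trans _ _ (expR (- (dl * (1 + dl) * x)) * expR (((1 + dl) * l) ^+ 2 / 2 * v))).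
    by rewrite ler_wpM2l // expR_ge0.
  rewrite -!expRD ler_expR.
  have -> : ((1 + dl) * l) ^+ 2 / 2 * v = (1 + dl) ^+ 2 / 2 * (l ^+ 2 * v) by ring.
  by rewrite l2v; lra.
have e : expR (- (x * (2^-1 + dl))) = expR (x / 2) / expR (x * (1 + dl)).
  by rewrite -expRB; congr expR; field.
rewrite e mulrAC ler_pdivrMr ?expR_gt0 //.
lra.
Qed.

End avg_theory.

(** * Probabilities of events depending on finitely many signs *)

Section rademacher.
Context {R : realType} {d : measure_display} {T : measurableType d}.
Context {P : probability T R} (X : nat -> {RV P >-> R}).

(* X i takes the values 1 and -1 only almost surely; rsgn i agrees with it there and
   is a sign everywhere. *)
Definition rsgn (i : nat) (w : T) : R := sgb (0 < X i w).

Definition signs (m n : nat) (w : T) : seq bool := [seq 0 < X i w | i <- iota m n].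

Lemma size_signs m n w : size (signs m n w) = n.
Proof. by rewrite size_map size_iota. Qed.

Lemma signsD m n k w : signs m (n + k) w = signs m n w ++ signs (m + n) k w.
Proof. by rewrite /signs iotaD map_cat. Qed.

Lemma wsum_signs (a : nat -> R) m n w :
  wsum a m (signs m n w) = \sum_(m <= i < m + n) a i * rsgn i w.
Proof.
elim: n m => [|n IH] m; first by rewrite addn0 big_geq.
rewrite big_ltn; last by rewrite addnS ltnS leq_addr.
by rewrite addnS -addSn -IH.
Qed.

Lemma hit_signs (a : nat -> R) t m n j w : (j <= n)%N ->
  t <= \sum_(m <= i < m + j) (a i * rsgn i w - a i ^+ 2 / 2) ->
  hit a t m (signs m n w).
Proof.
elim: n m j t => [|n IH] m j t.
  by rewrite leqn0 => /eqP ->; rewrite addn0 big_geq //= => ->.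
case: j => [|j].
  by rewrite addn0 big_geq //= => _ ->.
rewrite ltnS => jn; rewrite big_ltn; last by rewrite addnS ltnS leq_addr.
rewrite addnS -addSn => h /=; apply/orP; right; apply: (IH m.+1 j) => //.
by rewrite lerBlDl.
Qed.

Lemma measurable_half b : measurable [set x : R | (0 < x) = b].
Proof.
rewrite (_ : [set x : R | (0 < x) = b] = if b then `]0, +oo[%classic else `]-oo, 0]%classic).
  by case: b; exact: measurable_itv.
apply/seteqP; split => x; case: b => /=; rewrite in_itv /= ?andbT //.
  by move/negbT; rewrite -leNgt.
by move=> x0; apply/negbTE; rewrite -leNgt.
Qed.

Lemma measurable_preim i (A : set R) : measurable A -> measurable (X i @^-1` A).
Proof. by move=> mA; rewrite -[X in measurable X]setTI; exact: measurable_funP measurableT _ mA. Qed.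

Lemma measurable_pos i : measurable_fun setT (fun w => 0 < X i w).
Proof.
apply: (measurable_fun_bool true); rewrite setTI.
exact: (measurable_preim i _ (measurable_half true)).
Qed.

Lemma measurable_signs (U : seq bool -> R) m n :
  measurable_fun setT (fun w => U (signs m n w)).
Proof.
elim: n m U => [|n IH] m U; first exact: (measurable_cst (U [::])).
rewrite (_ : (fun w => U (signs m n.+1 w)) =
  (fun w => if 0 < X m w then U (true :: signs m.+1 n w) else U (false :: signs m.+1 n w))).
  by apply: measurable_fun_ifT; [exact: measurable_pos | exact: (IH m.+1 (fun s => U (true :: s))) | exact: (IH m.+1 (fun s => U (false :: s)))].
apply/funext => w; rewrite [signs m n.+1 w](_ : _ = (0 < X m w) :: signs m.+1 n w) //.
by case: (0 < X m w).
Qed.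

Lemma measurable_rsgn i : measurable_fun setT (rsgn i).
Proof. by apply: measurable_fun_ifT => //; exact: measurable_pos. Qed.

Lemma measurable_signs_event (E : pred (seq bool)) m n :
  measurable [set w | E (signs m n w)].
Proof.
have m1 : measurable [set x : R | (0 < x) = true] by exact: measurable_half.
have := measurable_signs (fun s => (E s)%:R) m n measurableT _ m1.
rewrite setTI; congr measurable; apply/seteqP; split => w /=.
  by case: (E _) => //; rewrite ltxx.
by move=> ->; rewrite ltr01.
Qed.

(** The event that the first signs are those of p, written as an intersection over a list of indices
    to match [mutually_independent]. *)
Definition cyl (p : seq bool) : set T :=
  \bigcap_(i in [set` iota 0 (size p)]) (X i @^-1` [set x | (0 < x) = nth false p i]).

Lemma measurable_cyl p : measurable (cyl p).
Proof.
rewrite /cyl; apply: fin_bigcap_measurable; first exact: finite_seq.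
by move=> i _; rewrite -[X in measurable X]setTI; exact: measurable_funP measurableT _ (measurable_half _).
Qed.

Lemma cylP p w : cyl p w <-> forall i, (i < size p)%N -> (0 < X i w) = nth false p i.
Proof.
split=> [h i ip|h i]; first by have := h i; rewrite /mkset mem_iota add0n; apply.
by rewrite /mkset mem_iota add0n => /andP[_ ip]; exact: h.
Qed.

Lemma cyl_nil : cyl [::] = setT.
Proof. by apply/seteqP; split => // w _; apply/cylP. Qed.

Lemma cyl_rcons p b : cyl (rcons p b) = cyl p `&` [set w | (0 < X (size p) w) = b].
Proof.
apply/seteqP; split => w.
  move=> /cylP; rewrite size_rcons => h; split.
    by apply/cylP => i ip; rewrite h ?nth_rcons ?ip // ltnW.
  by rewrite /mkset h // nth_rcons ltnn eqxx.
move=> [/cylP h1 h2]; apply/cylP => i; rewrite size_rcons ltnS leq_eqVlt => /orP[/eqP ->|ip].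
  by rewrite nth_rcons ltnn eqxx.
by rewrite nth_rcons ip h1.
Qed.

Hypothesis X_iid : iid X.
Hypothesis X_pos : P [set w | X 0%N w = 1] = (2^-1)%:E.
Hypothesis X_neg : P [set w | X 0%N w = - 1] = (2^-1)%:E.

Lemma P_same i (A : set R) : measurable A -> P (X i @^-1` A) = P (X 0%N @^-1` A).
Proof. by move=> mA; have := X_iid.2 i 0%N A mA. Qed.

(** The half lines contain 1 and -1 respectively, so each has probability at least 1/2; as they are
    complementary, both are equalities. *)
Lemma P_half b i : P (X i @^-1` [set x | (0 < x) = b]) = (2^-1)%:E.
Proof.
rewrite P_same; last exact: measurable_half.
have m1 := @measurable_preim 0%N _ (measurable_half true).
have m2 := @measurable_preim 0%N _ (measurable_half false).
have mp : measurable [set w | X 0%N w = 1] by exact: (@measurable_preim 0%N _ (measurable_set1 1)).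
have mn : measurable [set w | X 0%N w = -1] by exact: (@measurable_preim 0%N _ (measurable_set1 (-1))).
have h1 : ((2^-1)%:E <= P (X 0%N @^-1` [set x | (0 < x)%R = true]))%E.
  by rewrite -X_pos; apply: le_measure; rewrite ?inE // => w /= ->; exact: ltr01.
have h2 : ((2^-1)%:E <= P (X 0%N @^-1` [set x | (0 < x)%R = false]))%E.
  by rewrite -X_neg; apply: le_measure; rewrite ?inE // => w /= ->; rewrite ltr0N1.
have h3 : (P (X 0%N @^-1` [set x | (0 < x)%R = true]) +
           P (X 0%N @^-1` [set x | (0 < x)%R = false]) = 1)%E.
  rewrite -measureU //; last by rewrite -subset0 => w [/= -> ].
  rewrite -[RHS](@probability_setT _ _ _ P); congr (P _).
  by apply/seteqP; split => // w _ /=; case: (0 < _)%R; [left|right].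
rewrite -(fineK (fin_num_measure P _ m1)) -(fineK (fin_num_measure P _ m2)) in h1 h2 h3 *.
move: h1 h2 h3; rewrite -EFinD !lee_fin => h1 h2 [h3].
by case: b; [rewrite -(fineK (fin_num_measure P _ m1)) | rewrite -(fineK (fin_num_measure P _ m2))]; congr EFin; lra.
Qed.

Lemma P_cyl p : P (cyl p) = (2^-1 ^+ size p)%:E.
Proof.
rewrite (X_iid.1 (iota 0 (size p)) (fun i => [set x | (0 < x) = nth false p i])).
- under eq_bigr do rewrite P_half.
  by rewrite prodEFin -[X in iota 0 X]subn0 -/(index_iota 0 _) prodr_const_nat subn0.
- exact: iota_uniq.
- by move=> i; exact: measurable_half.
Qed.

(** Stated on a cylinder so that the induction can split on the next sign, which lengthens the
    prefix p. *)
Lemma integral_cyl_signs p n (f : seq bool -> R) : (forall s, 0 <= f s) ->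
  (\int[P]_(w in cyl p) (f (signs (size p) n w))%:E = (2^-1 ^+ size p * avg n f)%:E)%E.
Proof.
elim: n p f => [|n IH] p f f0.
  rewrite [LHS](_ : _ = \int[P]_(w in cyl p) (cst (f [::])%:E w))%E //.
  rewrite integral_cst; last exact: measurable_cyl.
  transitivity ((f [::])%:E * (2^-1 ^+ size p)%:E)%E; last by rewrite -EFinM mulrC.
  by congr (_ * _)%E; exact: P_cyl.
have cE : cyl p = cyl (rcons p true) `|` cyl (rcons p false).
  rewrite !cyl_rcons -setIUr; apply/seteqP; split => w; last by case.
  by move=> h; split => //=; case: (0 < _); [left|right].
rewrite {1}cE (@ge0_integral_setU _ _ _ P _ _ (measurable_cyl _) (measurable_cyl _)); last 3 first.
- apply: measurable_funTS; apply/measurable_EFinP; exact: measurable_signs.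
- by move=> w _; rewrite lee_fin.
- apply/disj_setPS; rewrite !cyl_rcons => w [[_ /= ->] [_ /= ]] //.
have e b : (\int[P]_(w in cyl (rcons p b)) (f (signs (size p) n.+1 w))%:E =
   (2^-1 ^+ (size p).+1 * avg n (fun s => f (b :: s)))%:E)%E.
  rewrite -[in RHS](size_rcons p b) -IH //; apply: eq_integral => w.
  rewrite inE cyl_rcons size_rcons => -[_ hb].
  have hb' : (0 < X (size p) w) = b := hb.
  by rewrite (_ : signs (size p) n.+1 w = (0 < X (size p) w) :: signs (size p).+1 n w) // hb'.
by rewrite !e -EFinD exprS /=; congr EFin; field.
Qed.

Lemma integral_signs n (f : seq bool -> R) : (forall s, 0 <= f s) ->
  (\int[P]_w (f (signs 0 n w))%:E = (avg n f)%:E)%E.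
Proof. by move=> f0; have := integral_cyl_signs [::] n f f0; rewrite cyl_nil expr0 mul1r. Qed.

Lemma P_signs n (E : pred (seq bool)) :
  P [set w | E (signs 0 n w)] = (avg n (fun s => (E s)%:R))%:E.
Proof.
rewrite -integral_signs; last by move=> s; case: (E s).
transitivity (P ([set w | E (signs 0 n w)] `&` setT)); first by rewrite setIT.
rewrite -integral_indic //; last exact: measurable_signs_event.
apply: eq_integral => w _; rewrite indicE; case hE : (E (signs 0 n w)).
  by rewrite mem_set.
by rewrite memNset //= hE.
Qed.

Definition expmart (a : nat -> R) n w := \sum_(0 <= i < n) (a i * rsgn i w - a i ^+ 2 / 2).

(** The event is the increasing union of its finite-horizon versions, each contained in a [hit]
    event. The bound does not depend on the horizon, so it passes to the union. *)
Lemma maximal_inequality (a : nat -> R) t :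
  measurable [set w | exists n, t <= expmart a n w] /\
  (P [set w | exists n, (t <= expmart a n w)%R] <= (expR (- t))%:E)%E.
Proof.
pose F n := [set w | exists2 j, (j <= n)%N & t <= expmart a j w].
have FE : [set w | exists n, t <= expmart a n w] = \bigcup_n F n.
  apply/seteqP; split => w /=; first by move=> [n h]; exists n => //; exists n.
  by move=> [n _ [j _ h]]; exists j.
have mE j : measurable [set w | t <= expmart a j w].
  have mf : measurable_fun setT (expmart a j).
    apply: measurable_sum => i; apply: measurable_funB => //.
    by apply: measurable_funM => //; exact: measurable_rsgn.
  have := mf measurableT _ (measurable_itv `[t, +oo[); rewrite setTI; congr measurable.
  by apply/seteqP; split => w /=; rewrite in_itv /= andbT.
have mF n : measurable (F n).
  rewrite (_ : F n = \bigcup_(j in `I_n.+1) [set w | t <= expmart a j w]).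
    by apply: fin_bigcup_measurable => // j _; exact: mE.
  by apply/seteqP; split => w [j h1 h2]; exists j.
have mU : measurable (\bigcup_n F n) by exact: bigcup_measurable.
rewrite FE; split => //.
have cv : P \o F @ \oo --> P (\bigcup_n F n).
  apply: nondecreasing_cvg_mu => //.
  move=> m n mn; apply/subsetPset => w [j jm h]; exists j => //; exact: leq_trans mn.
rewrite -(cvg_lim _ cv) //; apply: lime_le; first by apply/cvg_ex; eexists; exact: cv.
apply: nearW => n /=.
apply: (@le_trans _ _ (P [set w | hit a t 0 (signs 0 n w)])).
  apply: le_measure; rewrite ?inE //; first exact: measurable_signs_event.
  by move=> w [j jn h]; apply: (@hit_signs a t 0 n j).
by rewrite P_signs lee_fin avg_hit_le.
Qed.

(** The condition on all J blocks is encoded as one predicate on the first [M J] signs, built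
    together with its average; [avg_cat] then supplies one factor per block. *)
Lemma block_indep (M : nat -> nat) (E : nat -> pred (seq bool)) J :
  {homo M : m n / (m <= n)%N} ->
  P [set w | forall k, (k < J)%N -> ~~ E k (signs (M k) (M k.+1 - M k) w)] =
  (\prod_(0 <= k < J) (1 - avg (M k.+1 - M k) (fun s => (E k s)%:R)))%:E.
Proof.
move=> hM.
suff [h [hE hP]] : exists h : pred (seq bool),
  (forall w, h (signs 0 (M J) w) <-> forall k, (k < J)%N -> ~~ E k (signs (M k) (M k.+1 - M k) w)) /\
  avg (M J) (fun s => (h s)%:R) =
  \prod_(0 <= k < J) (1 - avg (M k.+1 - M k) (fun s => (E k s)%:R)) :> R.
  rewrite -hP -P_signs; congr (P _); apply/seteqP.
  by split => w /=; rewrite -hE.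
elim: J => [|J [h [hE hP]]].
  by exists predT; split => //; rewrite avg_cst big_geq.
pose h' s := h (take (M J) s) && ~~ E J (drop (M J) s).
have MJ : (M J <= M J.+1)%N by exact: hM.
have MJE : M J.+1 = (M J + (M J.+1 - M J))%N by rewrite subnKC.
exists h'; split.
  move=> w; rewrite /h' {1 2}MJE signsD add0n.
  rewrite take_size_cat ?size_signs // drop_size_cat ?size_signs //.
  split=> [/andP[/hE h1 h2] k|h1].
    by rewrite ltnS leq_eqVlt => /orP[/eqP ->//|]; exact: h1.
  by apply/andP; split; [apply/hE => k kJ; apply: h1; exact: ltnW|exact: h1].
rewrite big_nat_recr //= -hP {1}MJE.
rewrite (@eq_avg _ _ _ (fun s => (h (take (M J) s))%:R * (~~ E J (drop (M J) s))%:R)); last first.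
  by move=> s _; rewrite /h'; case: (h _); case: (E _ _); rewrite /= ?mulr0 ?mul0r ?mulr1.
rewrite (avg_cat (M J) (M J.+1 - M J) (fun s => (h s)%:R) (fun s => (~~ E J s)%:R)).
congr (_ * _); rewrite (@eq_avg _ _ _ (fun s => 1 + -1 * (E J s)%:R)); last first.
  by move=> s _; case: (E J s) => /=; ring.
by rewrite avgD avgZ avg_cst mulN1r.
Qed.

Lemma borel_cantelli_eventually (F : nat -> set T) (c : nat -> R) (C : R) :
  (forall k, measurable (F k)) -> (forall k, (P (F k) <= (c k)%:E)%E) ->
  (forall n, \sum_(0 <= k < n) c k <= C) ->
  {ae P, forall w, exists K, forall k, (K <= k)%N -> ~ F k w}.
Proof.
move=> mF Pc cC.
have fin : (\sum_(n <oo) P (F n) < +oo)%E.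
  apply: (@le_lt_trans _ _ C%:E); last exact: ltry.
  apply: lime_le; first by apply: is_cvg_nneseries => *; exact: measure_ge0.
  apply: nearW => n; apply: (@le_trans _ _ (\sum_(0 <= k < n) (c k)%:E)%E).
    by apply: lee_sum => i _.
  by rewrite sumEFin lee_fin.
have h0 := lim_sup_set_cvg0 mF fin.
exists (lim_sup_set F); split => //.
  by apply: bigcap_measurable => // k _; exact: bigcup_measurable.
move=> w /= h n _; apply: contrapT => h2; apply: h; exists n => k nk Fk.
by apply: h2; exists k.
Qed.

(** Avoiding J consecutive events has probability at most the product of the 1 - q, hence at most
    exp(- sum q), which is arbitrarily small for every starting index j. *)
Lemma borel_cantelli_blocks (M : nat -> nat) (E : nat -> pred (seq bool)) (q : nat -> R) :
  {homo M : m n / (m <= n)%N} ->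
  (forall k, q k <= avg (M k.+1 - M k) (fun s => (E k s)%:R)) ->
  (forall j A, exists J, A <= \sum_(0 <= k < J) q (j + k)%N) ->
  {ae P, forall w, forall j, exists2 k, (j <= k)%N & E k (signs (M k) (M k.+1 - M k) w)}.
Proof.
move=> hM qE qd; apply: ae_foralln => j.
pose M' k := M (j + k)%N; pose E' k := E (j + k)%N.
have hM' : {homo M' : m n / (m <= n)%N} by move=> m n mn; apply: hM; rewrite leq_add2l.
pose B J := [set w | forall k, (k < J)%N -> ~~ E' k (signs (M' k) (M' k.+1 - M' k) w)].
have mB J : measurable (B J).
  rewrite (_ : B J = \bigcap_(k in `I_J) [set w | ~~ E' k (signs (M' k) (M' k.+1 - M' k) w)]).
    apply: fin_bigcap_measurable => // k _.
    exact: (measurable_signs_event (fun s => ~~ E' k s)).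
  by apply/seteqP; split => w h k /=; exact: h.
have PB J : (P (B J) <= (expR (- \sum_(0 <= k < J) q (j + k)%N))%:E)%E.
  rewrite /B (@block_indep M' E' J hM') lee_fin -sumrN expR_sum; apply: ler_prod => k _.
  rewrite subr_ge0 -[leRHS](avg_cst (M' k.+1 - M' k) 1) le_avg /=; last by move=> s _; case: (E' k s).
  have := qE (j + k)%N; rewrite -addnS => h.
  apply: le_trans (expR_ge1Dx _); rewrite lerD2l lerN2; exact: h.
exists (\bigcap_J B J); split; first exact: bigcap_measurable.
  apply/eqP; rewrite eq_le measure_ge0 andbT; apply/lee_addgt0Pr => e e0; rewrite add0e.
  have [J hJ] := qd j (- ln e).
  apply: (@le_trans _ _ (P (B J))).
    apply: le_measure; rewrite ?inE //; first exact: bigcap_measurable.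
    by move=> w; apply.
  apply: le_trans (PB J) _; rewrite lee_fin -[leRHS](@lnK _ e) ?posrE //.
  by rewrite ler_expR lerNl.
move=> w /= h J _ k _; apply/negP => hE; apply: h; exists (j + k)%N; first exact: leq_addr.
by rewrite -addnS.
Qed.

End rademacher.

(** * Dirichlet series with controlled partial sums *)

Section dirichlet.
Context {R : realType} (x : nat -> R).
Implicit Types (u v B e : R) (m n : nat).

Definition psum n : R := \sum_(0 <= i < n) x i * npow 2^-1 i.
Definition dsum u n : R := \sum_(0 <= i < n) x i * npow (2^-1 + u) i.
Definition dlim u : R := limn (dsum u).
Definition growth B u := forall n, `|psum n.+1| <= B * npow (- (u / 4)) n.

Lemma psum0 : psum 0 = 0.
Proof. by rewrite /psum big_geq. Qed.

Lemma psumS_sub i : psum i.+1 - psum i = x i * npow 2^-1 i.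
Proof. by rewrite /psum big_nat_recr //= addrAC subrr add0r. Qed.

Lemma term_psum u i : x i * npow (2^-1 + u) i = (psum i.+1 - psum i) * npow u i.
Proof. by rewrite psumS_sub npowD mulrA. Qed.

(** A bound obtained at a small u thus serves every larger one, which reduces continuous u to
    countably many scales. *)
Lemma growth_le B u v : u <= v -> growth B u -> growth B v.
Proof.
move=> uv h n; apply: le_trans (h n) _.
have B0 : 0 <= B by have := h 0%N; rewrite npow_at0 mulr1; apply: le_trans.
by rewrite ler_wpM2l // npow_le // lerN2 ler_pM2r // invr_gt0.
Qed.

Lemma npow_small (s e : R) : 0 < s -> 0 < e -> exists N, forall m, (N <= m)%N -> npow s m < e.
Proof.
move=> s0 e0; pose N := Num.truncn (expR (- ln e / s)).
exists N => m Nm.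
rewrite /npow -[ltRHS](@lnK _ e) ?posrE // ltr_expR mulNr ltrNl.
rewrite mulrC -ltr_pdivrMr // -ltr_expR lnK ?posrE ?ltr0n //.
apply: lt_le_trans (truncnS_gt _) _.
by rewrite ler_nat ltnS.
Qed.

Section tail.
Variables (B u : R).
Hypothesis u0 : 0 < u.
Hypothesis gB : growth B u.

Lemma dsum_tail m n : (m < n)%N -> `|dsum u n - dsum u m.+1| <= 4 * B * npow (3 / 4 * u) m.
Proof.
move=> mn; rewrite /dsum (big_cat_nat (n := m.+1)) //= addrAC subrr add0r.
under eq_bigr do rewrite term_psum.
exact: (@abel_tail R psum B u u0 gB).
Qed.

Lemma dsum_cvg : cvgn (dsum u).
Proof.
have B0 := @growth_ge0 R psum B u gB.
apply: cauchy_cvg; apply: cauchy_exP => e e0.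
have c0 : 0 < 4 * B + 1 by rewrite ltr_wpDl // mulr_ge0.
have [N hN] := @npow_small (3 / 4 * u) (e / (4 * B + 1)) ltac:(by rewrite mulr_gt0 // divr_gt0) ltac:(by rewrite divr_gt0).
exists (dsum u N.+1).
suff : \forall k \near \oo, ball (dsum u N.+1) e (dsum u k) by [].
near=> k; rewrite /ball /= /ball_ /= distrC.
apply: le_lt_trans (dsum_tail N k _) _.
  by near: k; exact: nbhs_infty_gt.
have := hN _ (leqnn N); rewrite ltr_pdivlMr // => h; apply: le_lt_trans h.
by rewrite mulrC ler_wpM2l ?npow_ge0 // lerDl.
Unshelve. all: by end_near.
Qed.

Lemma dlim_tail m : `|dlim u - dsum u m.+1| <= 4 * B * npow (3 / 4 * u) m.
Proof.
have c : (fun n => `|dsum u n - dsum u m.+1|) @ \oo --> `|dlim u - dsum u m.+1|.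
  by apply: cvg_norm; apply: cvgB; [exact: dsum_cvg | exact: cvg_cst].
rewrite -(cvg_lim _ c) //; apply: limr_le; first by apply/cvg_ex; eexists; exact: c.
near=> n; apply: dsum_tail; near: n; exact: nbhs_infty_gt.
Unshelve. all: by end_near.
Qed.


End tail.

Lemma dlim_osc B u v : 0 < u -> growth B u -> u <= 1 -> u <= v ->
  `|dlim u - dlim v| <= 16 * B * ((v - u) / u).
Proof.
move=> u0 gB u1 uv; have v0 : 0 < v by exact: lt_le_trans uv.
have cu := dsum_cvg B u u0 gB; have cv := dsum_cvg B v v0 (growth_le B u v uv gB).
have c : (fun n => `|dsum u n - dsum v n|) @ \oo --> `|dlim u - dlim v|.
  by apply: cvg_norm; exact: (cvgB cu cv).
rewrite -(cvg_lim _ c) //; apply: limr_le; first by apply/cvg_ex; eexists; exact: c.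
apply: nearW => n; rewrite /dsum -sumrB.
under eq_bigr do rewrite !term_psum -mulrBr.
exact: (@abel_osc R psum B u u0 gB psum0 u1).
Qed.

Lemma dsum_init C u n : 0 <= u -> (forall j, (j < n)%N -> `|psum j.+1| <= C) -> 0 <= C ->
  `|dsum u n| <= C.
Proof.
move=> u0 h C0; rewrite /dsum; under eq_bigr do rewrite term_psum.
apply: abel_init => //; first exact: psum0.
by case=> [|j] jn; [rewrite psum0 normr0 | exact: h].
Qed.

End dirichlet.

(** * Almost sure upper bounds along geometric scales *)

Section scales.
Context {R : realType}.
Implicit Types (y c e : R) (i n : nat).

(* The target size of the series at u = exp(-y), since then log log (1/u) = ln y. *)
Definition psi y : R := Num.sqrt (expR y * ln y).

Lemma psi_ge0 y : 0 <= psi y.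
Proof. exact: sqrtr_ge0. Qed.

(** At y = (i+1) c a probability exp(-2 ln y) is a multiple of (i+1)^(-2), the summable form needed
    for Borel-Cantelli. *)
Lemma expR_neg2ln c i : 0 < c -> expR (- (2 * ln (i.+1%:R * c))) = c ^- 2 * npow 2 i.
Proof.
move=> c0; rewrite lnM ?posrE ?ltr0n // mulrDr opprD expRD mulrC /npow mulNr; congr (_ * _).
by rewrite -mulrN mulrC -[2]/(2%:R) expRM_natr expRN lnK ?posrE // exprVn.
Qed.

Lemma expR_powln c e i : 0 < c ->
  expR (- (e * ln (i.+1%:R * c))) = expR (- (e * ln c)) * npow e i.
Proof.
move=> c0; rewrite lnM ?posrE ?ltr0n // /npow -expRD; congr expR; ring.
Qed.

End scales.

Section as_bounds.
Context {R : realType} {d : measure_display} {T : measurableType d}.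
Context {P : probability T R} (X : nat -> {RV P >-> R}).
Hypothesis X_iid : iid X.
Hypothesis X_pos : P [set w | X 0%N w = 1] = (2^-1)%:E.
Hypothesis X_neg : P [set w | X 0%N w = - 1] = (2^-1)%:E.

Notation sg w := (fun i => rsgn X i w).

Lemma maximal_eventually (a : nat -> nat -> R) (t : nat -> R) (c : nat -> R) (C : R) :
  (forall k, expR (- t k) <= c k) -> (forall n, \sum_(0 <= k < n) c k <= C) ->
  {ae P, forall w, exists K, forall k, (K <= k)%N -> forall n, expmart X (a k) n w < t k}.
Proof.
move=> tc cC.
have H := @borel_cantelli_eventually R d T P (fun k => [set w | exists n, t k <= expmart X (a k) n w]) c C
  (fun k => (maximal_inequality X X_iid X_pos X_neg (a k) (t k)).1) _ cC.
apply: filterS (H _) => [w [K hK]|k]; last first.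
  by apply: le_trans (maximal_inequality X X_iid X_pos X_neg (a k) (t k)).2 _; rewrite lee_fin.
exists K => k Kk n.
by rewrite ltNge; apply/negP => h; apply: (hK k Kk); exists n.
Qed.

(** The exponential bound solved for the sum; the two terms on the right balance when l^2 is 2t
    divided by the sum of squares. *)
Lemma expmart_sum_le (l : R) (b : nat -> R) t n w : 0 < l ->
  expmart X (fun i => l * b i) n w < t ->
  \sum_(0 <= i < n) b i * rsgn X i w <= t / l + l / 2 * \sum_(0 <= i < n) b i ^+ 2.
Proof.
move=> l0; rewrite /expmart sumrB.
under eq_bigr do rewrite -mulrA.
rewrite -mulr_sumr.
under [X in _ - X < _ -> _]eq_bigr do rewrite exprMn mulrAC.
rewrite -mulr_sumr => h.
rewrite -(ler_pM2l l0) mulrDr mulrCA divff ?gt_eqF // mulr1 mulrA.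
have -> : l * (l / 2) = l ^+ 2 / 2 by ring.
lra.
Qed.

Lemma npow_half_sq i : npow 2^-1 i ^+ 2 = npow 1 i :> R.
Proof. by rewrite expr2 -npowD; congr (npow _ i); field. Qed.

(** The multiplier lam = u psi y does not depend on n. The threshold 2 ln y contributes 2 psi and
    the variance at most psi u (1 + ln n)/2; both fit into 3 psi (1 + (u/4) ln n) <= 3 psi
    n^(u/4). *)
Lemma growth_eventually (c : R) : 0 < c ->
  {ae P, forall w, exists K, forall k, (K <= k)%N ->
    growth (sg w) (3 * psi (k.+1%:R * c)) (expR (- (k.+1%:R * c)))}.
Proof.
move=> c0.
pose y k : R := k.+1%:R * c; pose u k := expR (- y k); pose L k := ln (y k).
pose lam k := Num.sqrt (u k * L k).
have sumc n : \sum_(0 <= k < n) c ^- 2 * npow 2 k <= c ^- 2 * (1 + 1^-1) :> R.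
  by rewrite -mulr_sumr ler_wpM2l ?invr_ge0 ?sqr_ge0 // sum_npow_le.
have tc k : expR (- (2 * L k)) <= c ^- 2 * npow 2 k by rewrite expR_neg2ln.
have H1 := @maximal_eventually (fun k i => lam k * npow 2^-1 i) _ _ _ tc sumc.
have H2 := @maximal_eventually (fun k i => lam k * - npow 2^-1 i) _ _ _ tc sumc.
apply: filterS2 H1 H2 => w [K1 h1] [K2 h2].
(* From K3 on, y k exceeds exp(1), so that ln (y k) and the multiplier are positive. *)
pose K3 := Num.truncn (expR 1 / c).
exists (maxn K3 (maxn K1 K2)) => k; rewrite !geq_max => /and3P[k3 k1 k2] n.
have y1 : 1 < y k.
  have : expR 1 / c < k.+1%:R.
    by apply: lt_le_trans (truncnS_gt _) _; rewrite ler_nat ltnS.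
  rewrite ltr_pdivrMr // => h; apply: lt_trans h; by rewrite expR_gt1.
have L0 : 0 < L k by exact: ln_gt0.
have u0 : 0 < u k by exact: expR_gt0.
have u1 : u k <= 1 by rewrite -[leRHS]expR0 ler_expR oppr_le0 ltW // (lt_trans ltr01).
have l0 : 0 < lam k by rewrite sqrtr_gt0 mulr_gt0.
have p0 : 0 < psi (y k) by rewrite sqrtr_gt0 mulr_gt0 ?expR_gt0.
have uE : expR (y k) = (u k)^-1 by rewrite /u expRN invrK.
have lamE : lam k = psi (y k) * u k.
  apply/eqP; rewrite -(@eqrXn2 _ 2) // ?mulr_ge0 // ?ltW //.
  rewrite exprMn /lam /psi !sqr_sqrtr ?mulr_ge0 ?expR_ge0 ?(ltW u0) ?(ltW L0) //.
  by rewrite uE -/(L k); apply/eqP; field; rewrite gt_eqF.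
have LE : L k = psi (y k) ^+ 2 * u k.
  rewrite sqr_sqrtr ?mulr_ge0 ?expR_ge0 ?(ltW L0) // uE -/(L k); field; by rewrite gt_eqF.
have bnd (b : nat -> R) : (forall i, b i ^+ 2 = npow 1 i) ->
    expmart X (fun i => lam k * b i) n.+1 w < 2 * L k ->
    \sum_(0 <= i < n.+1) b i * rsgn X i w <= 3 * psi (y k) * npow (- (u k / 4)) n.
  move=> bE /(expmart_sum_le _ _ _ _ _ l0) h; apply: le_trans h _.
  under eq_bigr do rewrite bE.
  have hs : lam k / 2 * \sum_(0 <= i < n.+1) npow 1 i <= lam k / 2 * (1 + ln n.+1%:R).
    by rewrite ler_wpM2l ?divr_ge0 ?(ltW l0) // sum_npow1_le.
  have -> : 2 * L k / lam k = 2 * psi (y k).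
    by rewrite lamE LE; field; rewrite !gt_eqF.
  have he : 1 + u k / 4 * ln n.+1%:R <= npow (- (u k / 4)) n.
    by rewrite /npow opprK expR_ge1Dx.
  have hl := @ln_succ_ge0 R n.
  have ul0 : 0 <= u k * ln n.+1%:R by rewrite mulr_ge0 // ltW.
  apply: (@le_trans _ _ (psi (y k) * (3 * (1 + u k / 4 * ln n.+1%:R)))); last first.
    by rewrite mulrA [psi (y k) * 3]mulrC ler_wpM2l // mulr_ge0 // ltW.
  apply: le_trans (lerD (lexx _) hs) _; rewrite lamE.
  have h5 : 0 <= psi (y k) * (u k * ln n.+1%:R) by rewrite mulr_ge0 // ltW.
  have h6 : psi (y k) * u k <= psi (y k) by rewrite ler_piMr // ltW.
  by have := ltW p0; lra.
have b1 := bnd (npow 2^-1) npow_half_sq (h1 k k1 n.+1).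
have b2 := bnd (fun i => - npow 2^-1 i) (fun i => etrans (sqrrN _) (npow_half_sq i)) (h2 k k2 n.+1).
rewrite -/(y k) -/(u k) /psum ler_norml.
under eq_bigr do rewrite mulrC.
rewrite b1 andbT lerNl -sumrN.
by under eq_bigr do rewrite -mulNr.
Qed.

Lemma npow_half_sq2 u i : npow (2^-1 + u) i ^+ 2 = npow (1 + 2 * u) i :> R.
Proof. by rewrite expr2 -npowD; congr (npow _ i); field. Qed.

(** Here the variance is bounded uniformly in n by W = 1 + 1/(2u), so the optimal multiplier
    sqrt(2t/W) serves all n. The threshold t = (1 + e) ln y gives probabilities bounded by a
    multiple of (k+1)^(-1-e), which is still summable. *)
Lemma dsum_eventually (c e : R) : 0 < c -> 0 < e ->
  {ae P, forall w, exists K, forall k, (K <= k)%N -> forall n,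
    let y := k.+1%:R * c in
    dsum (sg w) (expR (- y)) n <=
    Num.sqrt (2 * ((1 + e) * ln y) * (1 + (2 * expR (- y))^-1))}.
Proof.
move=> c0 e0.
pose y k : R := k.+1%:R * c; pose u k := expR (- y k).
pose W k := 1 + (2 * u k)^-1; pose t k := (1 + e) * ln (y k).
pose lam k := Num.sqrt (2 * t k / W k).
have sumc n : \sum_(0 <= k < n) expR (- ((1 + e) * ln c)) * npow (1 + e) k <=
    expR (- ((1 + e) * ln c)) * (1 + e^-1) :> R.
  by rewrite -mulr_sumr ler_wpM2l ?expR_ge0 // sum_npow_le.
have tc k : expR (- t k) <= expR (- ((1 + e) * ln c)) * npow (1 + e) k by rewrite expR_powln.
have H1 := @maximal_eventually (fun k i => lam k * npow (2^-1 + u k) i) _ _ _ tc sumc.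
apply: filterS H1 => w [K1 h1].
pose K3 := Num.truncn (expR 1 / c).
exists (maxn K3 K1) => k; rewrite !geq_max => /andP[k3 k1] n /=.
rewrite -/(y k) -/(u k).
have y1 : 1 < y k.
  have : expR 1 / c < k.+1%:R.
    by apply: lt_le_trans (truncnS_gt _) _; rewrite ler_nat ltnS.
  rewrite ltr_pdivrMr // => h; apply: lt_trans h; by rewrite expR_gt1.
have t0 : 0 < t k by rewrite mulr_gt0 ?addr_gt0 // ln_gt0.
have u0 : 0 < u k by exact: expR_gt0.
have W0 : 0 < W k by rewrite addr_gt0 // invr_gt0 mulr_gt0.
have l0 : 0 < lam k by rewrite sqrtr_gt0 divr_gt0 // mulr_gt0.
have := expmart_sum_le _ _ _ _ _ l0 (h1 k k1 n).
rewrite /dsum; under eq_bigr do rewrite mulrC; move=> h; apply: le_trans h _.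
under eq_bigr do rewrite npow_half_sq2.
apply: (@le_trans _ _ (t k / lam k + lam k / 2 * W k)).
  by rewrite lerD2l ler_wpM2l ?divr_ge0 ?(ltW l0) // sum_npow_le // mulr_gt0.
have lE : lam k ^+ 2 * W k = 2 * t k.
  rewrite sqr_sqrtr ?divfK ?gt_eqF // divr_ge0 ?(ltW W0) // mulr_ge0 //; exact: ltW.
rewrite -/(t k) -/(W k).
have -> : 2 * t k * W k = (lam k * W k) ^+ 2 by rewrite -lE; ring.
rewrite sqrtr_sqr ger0_norm ?mulr_ge0 ?(ltW l0) ?(ltW W0) //.
have -> : t k = lam k ^+ 2 * W k / 2 by rewrite lE; field.
rewrite le_eqVlt; apply/orP; left; apply/eqP; field; by rewrite gt_eqF.
Qed.

End as_bounds.

(** * Large blocks infinitely often *)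

Section blocks.
Context {R : realType} {d : measure_display} {T : measurableType d}.
Context {P : probability T R} (X : nat -> {RV P >-> R}).
Hypothesis X_iid : iid X.
Hypothesis X_pos : P [set w | X 0%N w = 1] = (2^-1)%:E.
Hypothesis X_neg : P [set w | X 0%N w = - 1] = (2^-1)%:E.

(** Divergence for the second Borel-Cantelli lemma: the block estimate 1/(2y) is available only from
    the index K0 on, so earlier terms are set to 0 and a tail of the harmonic series remains. *)
Lemma shifted_harmonic_unbounded (K0 j : nat) (C A : R) : 0 < C ->
  exists J, A <= \sum_(0 <= k < J) (if (K0 <= j + k)%N then npow 1 (j + k)%N / C else 0).
Proof.
move=> C0.
pose h k : R := if (K0 <= j + k)%N then npow 1 (j + k)%N / C else 0.
have h0 k : 0 <= h k by rewrite /h; case: ifP => // _; rewrite divr_ge0 ?npow_ge0 // ltW.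
pose J := (K0 + Num.truncn (expR (A * C + ln (j + K0).+1%:R))).+1.
exists J; rewrite (big_cat_nat (n := K0)) //=; last by rewrite /J -addnS leq_addr.
apply: ler_wpDl; first by apply: sumr_ge0 => k _; exact: h0.
apply: (@le_trans _ _ (\sum_(K0 <= k < J) (ln (j + k).+2%:R - ln (j + k).+1%:R) / C)).
  rewrite -mulr_suml ler_pdivlMr //.
  rewrite (telescope_sumr_eq (fun k => ln (j + k).+1%:R)); last first.
  - by move=> k _; rewrite addnS.
  - by rewrite /J -addnS leq_addr.
  rewrite lerBrDr -[leLHS]expRK ler_ln ?posrE ?expR_gt0 ?ltr0n //.
  apply: le_trans (ltW (truncnS_gt _)) _; rewrite ler_nat ltnS /J addnS addnCA.
  by rewrite leqW // addnA leq_addl.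
rewrite !big_nat; apply: ler_sum => k /andP[Kk _].
rewrite (leq_trans Kk) ?leq_addl // ler_pM2r ?invr_gt0 //.
by apply: le_trans (ln_succ_ub _) _; rewrite npow1.
Qed.

(** The constant 14 comes from [block_prob]: dl^2 x >= 14 gives exp(-dl^2 x/2) <= 1/(1 + 7). The
    last bound uses the cubic term of the exponential series, i.e. u <= 6/y^3. *)
Lemma large_scale_bounds (dl y : R) (u := expR (- y)) (l := ln y) :
  0 < dl -> dl < 8^-1 -> expR (14 / dl ^+ 2) <= y ->
  [/\ 0 < y, 14 / dl ^+ 2 <= l, 100 <= y, 4 * u <= dl & 4 * l ^+ 2 * u <= 4^-1].
Proof.
move=> dl0 dl8 y_large.
have y0 : 0 < y by apply: lt_le_trans y_large; exact: expR_gt0.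
have dl2 : 0 < dl ^+ 2 by rewrite exprn_gt0.
have h1 : 14 / dl ^+ 2 <= l by rewrite -ler_expR lnK ?posrE.
have h2 : 14 / dl ^+ 2 + 1 <= y by rewrite addrC; apply: le_trans (expR_ge1Dx _) y_large.
have dlle : dl ^+ 2 <= dl / 8 by rewrite expr2 ler_pM2l // ltW.
have h3 : 112 / dl <= 14 / dl ^+ 2.
  rewrite ler_pdivlMr // mulrAC ler_pdivrMr //.
  by have := ltW dl0; nra.
have h4 : 896 <= 112 / dl.
  by rewrite ler_pdivlMr //; lra.
have y100 : 100 <= y by lra.
have u1 : u <= y^-1.
  rewrite /u expRN lef_pV2 ?posrE ?expR_gt0 //.
  by have := expR_ge1Dx y; lra.
split => //.
  apply: (@le_trans _ _ (4 * y^-1)); first by rewrite ler_pM2l.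
  rewrite ler_pdivrMr //.
  have : 112 / dl <= y by lra.
  by rewrite ler_pdivrMr // mulrC; lra.
have ly : l <= y by rewrite ltW // ln_sublinear.
have l0 : 0 <= l by apply: ln_ge0; lra.
have e3 : 1 + y ^+ 3 / 3`!%:R <= expR y by apply: expR_ge1Dxn; exact: ltW.
have e4 : u * (y ^+ 3 / 6) <= 1.
  rewrite [leRHS](_ : 1 = u * expR y); last by rewrite /u mulrC expRxMexpNx_1.
  rewrite ler_pM2l ?expR_gt0 //; apply: le_trans e3.
  by rewrite (_ : 3`! = 6%N) // lerDr.
have e5 : l ^+ 2 <= y ^+ 2 by rewrite ler_pXn2r ?nnegrE // ltW.
have e6 : u * l ^+ 2 <= u * y ^+ 2 by rewrite ler_wpM2l ?expR_ge0.
have e7 : u * y ^+ 2 * 100 <= 6.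
  apply: (@le_trans _ _ (u * y ^+ 2 * y)); last by move: e4; rewrite -mulrA -exprSr; lra.
  by rewrite ler_wpM2l // mulr_ge0 ?expR_ge0 ?sqr_ge0.
lra.
Qed.

(** [lower_tail] at x = 2 (1 - 3 dl) ln y: the main factor is y to the power -(1 - 3 dl)(1 + 2 dl),
    at least 1/y, and the correction is at least 3/4 - 2/8 = 1/2. The level reached is still near
    psi y because (1 - 4 dl)^2 <= (1 - 3 dl)(1 - dl) for small dl. *)
Lemma block_prob (dl y : R) (u := expR (- y)) (l := ln y) (a : nat -> R) (m n : nat)
    (v := \sum_(m <= i < m + n) a i ^+ 2) :
  0 < dl -> dl < 8^-1 -> expR (14 / dl ^+ 2) <= y ->
  (forall i, `|a i| <= 1) -> 1 - dl <= 2 * u * v ->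
  (1 - 5 * dl) * psi y <= (1 - dl) * Num.sqrt (2 * (1 - 3 * dl) * l * v) /\
  (2 * y)^-1 <=
   avg n (fun s => ((1 - dl) * Num.sqrt (2 * (1 - 3 * dl) * l * v) <= wsum a m s)%R%:R).
Proof.
move=> dl0 dl8 y_large a1 uv.
have [y0 l14 y100 udl lu] := large_scale_bounds dl y dl0 dl8 y_large.
rewrite -/u -/l in l14 udl lu.
have u0 : 0 < u by exact: expR_gt0.
have d2 : 0 < 14 / dl ^+ 2 by rewrite divr_gt0 // exprn_gt0.
have l0 : 0 < l by exact: lt_le_trans l14.
have uv2 : 2^-1 <= 2 * u * v by lra.
have v0 : 0 < v.
  have u20 : 0 < 2 * u by rewrite mulr_gt0.
  by rewrite -(pmulr_rgt0 _ u20); apply: lt_le_trans uv2; rewrite invr_gt0.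
set x := 2 * (1 - 3 * dl) * l.
have x0 : 0 < x by rewrite !mulr_gt0 //; lra.
have xl : x <= 2 * l by rewrite /x -mulrA ler_pM2l // ler_piMl ?(ltW l0) //; lra.
have lx : l <= x.
  rewrite /x -[leLHS]mul1r ler_pM2r //; lra.
split.
  have eyE : expR y = u^-1 by rewrite /u expRN invrK.
  have h1 : (1 - 4 * dl) * psi y <= Num.sqrt (x * v).
    have -> : (1 - 4 * dl) * psi y = Num.sqrt ((1 - 4 * dl) ^+ 2 * (u^-1 * l)).
      rewrite sqrtrM ?sqr_ge0 // sqrtr_sqr ger0_norm; last by lra.
      by rewrite /psi eyE.
    rewrite ler_sqrt; last by rewrite mulr_ge0 // ltW.
    have hv : (1 - dl) / 2 * u^-1 <= v by rewrite ler_pdivrMr //; lra.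
    apply: (@le_trans _ _ (x * ((1 - dl) / 2 * u^-1))); last by rewrite ler_pM2l.
    have -> : x * ((1 - dl) / 2 * u^-1) = (1 - 3 * dl) * (1 - dl) * (u^-1 * l).
      by rewrite /x; field; rewrite gt_eqF.
    rewrite ler_wpM2r; first by [].
      by rewrite mulr_ge0 ?invr_ge0 // ltW.
    have : dl ^+ 2 <= dl / 8 by rewrite expr2 ler_pM2l // ltW.
    by have := sqr_ge0 dl; lra.
  have p0 := psi_ge0 y.
  apply: (@le_trans _ _ ((1 - dl) * ((1 - 4 * dl) * psi y))); last first.
    rewrite ler_wpM2l //; lra.
  rewrite mulrA ler_wpM2r //.
  by have := sqr_ge0 dl; lra.
have dl1 : 0 < dl < 1 by apply/andP; split => //; lra.
have := lower_tail a m n dl x dl1 x0 v0 a1.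
rewrite -/v; apply: le_trans.
have e1 : 3 / 4 <= expR (- (x ^+ 2 / (4 * v))).
  apply: le_trans (expR_ge1Dx _).
  have : x ^+ 2 / (4 * v) <= 4^-1.
    apply: le_trans lu.
    rewrite ler_pdivrMr; last by rewrite mulr_gt0.
    apply: (@le_trans _ _ ((2 * l) ^+ 2)).
      have x0' := ltW x0; have l20 : 0 <= 2 * l by rewrite mulr_ge0 // ltW.
      by rewrite ler_pXn2r ?nnegrE.
    have -> : 4 * l ^+ 2 * u * (4 * v) = (2 * l) ^+ 2 * (2 * (2 * u * v)) by ring.
    rewrite ler_peMr ?sqr_ge0 //; lra.
  lra.
have e2 : expR (- (dl ^+ 2 * x / 2)) <= 8^-1.
  rewrite expRN lef_pV2 ?posrE ?expR_gt0 //.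
  apply: le_trans (expR_ge1Dx _).
  have : 14 <= dl ^+ 2 * x.
    apply: (@le_trans _ _ (dl ^+ 2 * (14 / dl ^+ 2))).
      by rewrite mulrC divfK // gt_eqF // exprn_gt0.
    rewrite ler_pM2l ?exprn_gt0 //; exact: le_trans lx.
  lra.
have e3 : y^-1 <= expR (- (x * (2^-1 + dl))).
  rewrite -[y in y^-1](@lnK _ y) ?posrE // -expRN ler_expR lerN2 -/l.
  have -> : x * (2^-1 + dl) = l * ((1 - 3 * dl) * (1 + 2 * dl)) by rewrite /x; field.
  rewrite ler_piMr ?(ltW l0) //.
  by have := sqr_ge0 dl; lra.
rewrite invfM mulrC ler_pM ?invr_ge0 ?(ltW y0) //; lra.
Qed.

(** The condition on L and q makes the block carry all but a fraction dl of the variance 1/(2u): the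
    part before it accounts for about 2L/q, the part after it for 2^(-L) <= 1/(L+1). *)
Lemma blocks_io (dl : R) (L q : nat) : 0 < dl -> dl < 8^-1 -> (1 < q)%N ->
  2 * L%:R / q%:R + L.+1%:R^-1 <= dl / 2 ->
  {ae P, forall w, forall j, exists2 k, (j <= k)%N &
    let y := k.+1%:R * ln q%:R in
    (1 - 5 * dl) * psi y <=
    \sum_(2 ^ (L * q ^ k) <= i < 2 ^ (L * q ^ k.+1)) npow (2^-1 + expR (- y)) i * rsgn X i w}.
Proof.
move=> dl0 dl8 q1 Lq.
pose c : R := ln q%:R; pose y k := k.+1%:R * c; pose u k := expR (- y k).
pose M k := (2 ^ (L * q ^ k))%N; pose a k := npow (2^-1 + u k) : nat -> R.
pose v k := \sum_(M k <= i < M k + (M k.+1 - M k)) a k i ^+ 2.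
pose th k := (1 - dl) * Num.sqrt (2 * (1 - 3 * dl) * ln (y k) * v k).
have c0 : 0 < c by apply: ln_gt0; rewrite ltr1n.
have hM : {homo M : m n / (m <= n)%N}.
  by move=> m n mn; rewrite leq_exp2l // leq_mul2l leq_exp2l // mn orbT.
have q0 : 0 < q%:R :> R by rewrite ltr0n ltnW.
have uE k : u k = (q%:R ^+ k.+1)^-1.
  by rewrite /u /y expRN mulrC expRM_natr lnK ?posrE.
have lnME k : ln (M k)%:R = L%:R * q%:R ^+ k * ln 2 :> R.
  by rewrite /M natrX lnXn // -[_ *+ (L * q ^ k)]mulr_natl natrM natrX.
have ulM1 k : u k * ln (M k.+1)%:R = L%:R * ln 2.
  by rewrite lnME uE; field; rewrite expf_neq0 // gt_eqF.
have ulM k : u k * ln (M k)%:R = L%:R / q%:R * ln 2.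
  by rewrite lnME uE exprS; field; rewrite expf_neq0 gt_eqF //= gt_eqF.
have M0 k : (0 < M k)%N by rewrite expn_gt0.
have ln2 : ln 2 <= 1 :> R.
  by have := @le_ln1Dx R 1; rewrite -[1 + 1]/(2 : R); apply; lra.
have ln20 : 0 <= ln 2 :> R by apply: ln_ge0; lra.
pose K0 := Num.truncn (expR (14 / dl ^+ 2) / c).
have yK k : (K0 <= k)%N -> expR (14 / dl ^+ 2) <= y k.
  move=> Kk; rewrite -ler_pdivrMr //; apply: le_trans (ltW (truncnS_gt _)) _.
  by rewrite ler_nat ltnS.
have vb k : (K0 <= k)%N -> 1 - dl <= 2 * u k * v k.
  move=> Kk; have [y0 _ _ udl _] := large_scale_bounds dl (y k) dl0 dl8 (yK k Kk).
  have u0 : 0 < u k by exact: expR_gt0.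
  have u20 : 0 <= 2 * u k by rewrite mulr_ge0 // ltW.
  have -> : v k = \sum_(M k <= i < M k.+1) npow (1 + 2 * u k) i.
    rewrite /v subnKC ?hM //; apply: eq_bigr => i _; exact: npow_half_sq2.
  apply: le_trans (sum_npow_lb _ _ _ u20 (hM _ _ (leqnSn k))).
  have h1 : 1 - 2 * u k * ln (M k).+1%:R <= npow (2 * u k) (M k).
    by rewrite /npow -[X in 1 - X]opprK opprK -mulNr expR_ge1Dx.
  have h2 : ln (M k).+1%:R <= ln 2 + ln (M k)%:R :> R.
    rewrite -lnM ?posrE ?ltr0n // ler_ln ?posrE ?mulr_gt0 ?ltr0n //.
    by rewrite -natrM ler_nat mul2n -addnn -addn1 leq_add2l.
  have h3 : npow (2 * u k) (M k.+1) <= L.+1%:R^-1.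
    apply: (@le_trans _ _ (expR (- (L%:R * ln 2)))).
      rewrite /npow ler_expR mulNr lerN2 -(ulM1 k).
      have h : u k * ln (M k.+1)%:R <= u k * ln (M k.+1).+1%:R.
        by rewrite ler_pM2l // ler_ln ?posrE ?ltr0n // ler_nat.
      have : 0 <= u k * ln (M k.+1).+1%:R by rewrite mulr_ge0 ?ln_succ_ge0 // ltW.
      lra.
    rewrite expRN mulrC expRM_natr lnK ?posrE // lef_pV2 ?posrE ?exprn_gt0 ?ltr0n //.
    by rewrite -natrX ler_nat ltn_expl.
  have h4 : u k * ln (M k).+1%:R <= u k + L%:R / q%:R.
    apply: (@le_trans _ _ (u k * (ln 2 + ln (M k)%:R))); first by rewrite ler_pM2l.
    rewrite mulrDr ulM; apply: lerD; first by rewrite ler_piMr // ltW.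
    by rewrite ler_piMr // divr_ge0 // ltW.
  have h5 : 2 * (L%:R / q%:R) = 2 * L%:R / q%:R :> R by rewrite mulrA.
  have h6 := Lq; rewrite -h5 in h6; rewrite -/(u k) in udl.
  move: (L%:R / q%:R) (L.+1%:R^-1) h3 h4 h6 {h5} => r1 r2 h3 h4 h6.
  lra.
have a1 k i : `|a k i| <= 1.
  by rewrite ger0_norm ?npow_ge0 // npow_le1 // addr_ge0 ?invr_ge0 ?expR_ge0.
have qE k : (if (K0 <= k)%N then npow 1 k / (2 * c) else 0) <=
    avg (M k.+1 - M k) (fun s => (th k <= wsum (a k) (M k) s)%R%:R).
  case: ifP => [Kk|_]; last by apply: avg_ge0 => s; exact: ler0n.
  have [_ h] := block_prob dl (y k) (a k) (M k) (M k.+1 - M k) dl0 dl8 (yK k Kk) (a1 k) (vb k Kk).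
  apply: le_trans h; rewrite npow1 -invfM /y.
  by rewrite (_ : k.+1%:R * (2 * c) = 2 * (k.+1%:R * c)) //; ring.
have H := @borel_cantelli_blocks R d T P X X_iid X_pos X_neg M (fun k s => th k <= wsum (a k) (M k) s) _ hM qE.
have {}H := H (fun j A => shifted_harmonic_unbounded K0 j (2 * c) A ltac:(by rewrite mulr_gt0)).
apply: filterS H => w hw j; have [k] := hw (maxn j K0).
rewrite geq_max => /andP[jk Kk] hE; exists k => //=.
rewrite -/c -/(y k) -/(u k).
have [h _] := block_prob dl (y k) (a k) (M k) (M k.+1 - M k) dl0 dl8 (yK k Kk) (a1 k) (vb k Kk).
apply: le_trans h _; apply: le_trans hE _.
by rewrite wsum_signs subnKC ?hM.
Qed.

End blocks.

(** * The second moment *)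

Section lim_measurable.
Context {d : measure_display} {T : measurableType d} {R : realType}.
Variable h : nat -> T -> R.
Hypothesis mh : forall n, measurable_fun setT (h n).

(** Cauchy's criterion with the tolerances 1/(k+1), which expresses convergence by countable
    operations. *)
Lemma cvgn_set_cauchyE : [set w | cvgn (h ^~ w)] =
  \bigcap_k \bigcup_N \bigcap_(m in [set m | (N <= m)%N])
    [set w | `|h N w - h m w| < k.+1%:R^-1].
Proof.
apply/seteqP; split => w /=.
  move=> /cvg_ex[l hl] k _.
  have e0 : 0 < k.+1%:R^-1 / 2 :> R by rewrite divr_gt0 // invr_gt0 ltr0n.
  have /cvgrPdist_lt /(_ _ e0) [N _ hN] := hl.
  exists N => // m /= Nm.
  have h1 := hN N (leqnn N); have h2 := hN m Nm.
  rewrite -(subrKA l); apply: le_lt_trans (ler_normD _ _) _.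
  rewrite distrC in h1; rewrite [ltRHS]splitr; exact: ltrD.
move=> H; apply: cauchy_cvg; apply: cauchy_exP => e e0.
have [k hk] : exists k, k.+1%:R^-1 < e.
  exists (Num.truncn e^-1); rewrite invf_plt ?posrE ?ltr0n //; exact: truncnS_gt.
have [N _ hN] := H k I; exists (h N w).
suff : \forall m \near \oo, ball (h N w) e (h m w) by [].
near=> m; rewrite /ball /= /ball_ /=; apply: lt_trans hk; apply: hN.
by near: m; exact: nbhs_infty_ge.
Unshelve. all: by end_near.
Qed.

Lemma measurable_cvgn : measurable [set w | cvgn (h ^~ w)].
Proof.
rewrite cvgn_set_cauchyE; apply: bigcap_measurable => // k _.
apply: bigcup_measurable => N _; apply: bigcap_measurable => [|m _].
  by exists N => /=.
have mf : measurable_fun setT (fun w => `|h N w - h m w|).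
  by apply: measurableT_comp => //; exact: measurable_funB.
have := mf measurableT _ (measurable_itv `]-oo, (k.+1%:R^-1)[); rewrite setTI.
by rewrite (_ : [set w | _] = (fun w => `|h N w - h m w|) @^-1` `]-oo, (k.+1%:R^-1)[); last by apply/seteqP; split => w /=; rewrite in_itv.
Qed.

(** Off the measurable set of convergence [limn] is the constant [point], so measurability holds on
    the whole space. *)
Lemma measurable_limn : measurable_fun setT (fun w => limn (h ^~ w)).
Proof.
rewrite -(setUv [set w | cvgn (h ^~ w)]); apply/measurable_funU.
- exact: measurable_cvgn.
- exact: measurableC measurable_cvgn.
split.
  apply: (@measurable_fun_cvg _ _ _ _ h) => [m|w] //=.
  exact: measurable_funTS.
apply: (eq_measurable_fun (fun=> point)) => [w|]; last exact: measurable_cst.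
by rewrite inE /= => /dvgP ->.
Qed.

End lim_measurable.

(** The bound is asked only from N on because the remainder estimate applies it to F_n - F_(N+1),
    with n > N. *)
Lemma fatou_bound {d : measure_display} {T : measurableType d} {R : realType}
    (mu : {measure set T -> \bar R}) (f : nat -> T -> R) (g : T -> R) (C : R) (N : nat) :
  (forall n, measurable_fun setT (f n)) -> measurable_fun setT g ->
  (forall n w, 0 <= f n w) -> (forall w, 0 <= g w) ->
  {ae mu, forall w, f ^~ w @ \oo --> g w} ->
  (forall n, (N <= n)%N -> (\int[mu]_w (f n w)%:E <= C%:E)%E) ->
  (\int[mu]_w (g w)%:E <= C%:E)%E.
Proof.
move=> mf mg f0 g0 fg fC.
have mE n : measurable_fun setT (fun w => (f n w)%:E) by exact/measurable_EFinP.
rewrite (@ge0_ae_eq_integral _ _ _ mu setT _ (fun w => limn_einf (fun n => (f n w)%:E))) //.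
- apply: le_trans (fatou mu measurableT mE _) _; first by move=> n w _; rewrite lee_fin.
  rewrite limn_einf_lim; apply: lime_le; first exact: is_cvg_einfs.
  near=> n; apply: le_trans (einfs_le_esups _ n) _ => /=.
  apply: ge_ereal_sup => _ [m /= nm <-]; apply: fC; apply: leq_trans nm.
  by near: n; exact: nbhs_infty_ge.
- exact/measurable_EFinP.
- apply: measurableT_comp => //.
  apply: (@measurable_fun_limn_esup _ _ _ setT (fun n w => - (f n w)%:E)%E) => n.
  exact: measurableT_comp.
- by move=> w _; rewrite lee_fin.
- move=> w _; rewrite limn_einf_lim; apply: lime_ge; first exact: is_cvg_einfs.
  apply: nearW => n; apply: le_ereal_inf_tmp => _ [m _ <-]; by rewrite lee_fin.
- apply: filterS fg => w h _.
  have h' : (fun n => (f n w)%:E) @ \oo --> (g w)%:E.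
    by apply: cvg_EFin => //; exact: nearW.
  by rewrite (cvg_limn_einf_sup h').1.
Unshelve. all: by end_near.
Qed.

Section second_moment.
Context {R : realType} {d : measure_display} {T : measurableType d}.
Context {P : probability T R} (X : nat -> {RV P >-> R}).
Hypothesis X_iid : iid X.
Hypothesis X_pos : P [set w | X 0%N w = 1] = (2^-1)%:E.
Hypothesis X_neg : P [set w | X 0%N w = - 1] = (2^-1)%:E.

Notation sg w := (fun i => rsgn X i w).

Lemma ae_sign : {ae P, forall w, forall i, X i w = rsgn X i w}.
Proof.
apply: ae_foralln => i.
have m1 : measurable (X i @^-1` [set 1]) by apply: measurable_preim; exact: measurable_set1.
have m2 : measurable (X i @^-1` [set -1]) by apply: measurable_preim; exact: measurable_set1.
exists (~` (X i @^-1` [set 1] `|` X i @^-1` [set -1])); split.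
- by apply: measurableC; exact: measurableU.
- transitivity (1 - P (X i @^-1` [set 1%R] `|` X i @^-1` [set (-1)%R]))%E.
    by apply: probability_setC; exact: measurableU.
  rewrite measureU //; last by rewrite -subset0 => w [/= -> /eqP]; rewrite -subr_eq0 opprK -mulr2n pnatr_eq0.
  transitivity (1 - ((2^-1 : R)%:E + (2^-1 : R)%:E))%E; last first.
    have h : 2^-1 + 2^-1 = 1 :> R by lra.
    by rewrite -EFinD h; exact: (@subee R 1%:E).
  congr (1 - (_ + _))%E; [rewrite -X_pos | rewrite -X_neg];
    by apply: (P_same X X_iid i); exact: measurable_set1.
- move=> w /= h [h1|h1]; apply: h; rewrite /rsgn /sgb h1 ?ltr01 // ltr0N1 //.
Qed.

(** Every u > 0 has a scale exp(-(k+1)) below it, so a single null set serves all u. *)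
Lemma ae_growth : {ae P, forall w, forall u, 0 < u -> exists B, growth (sg w) B u}.
Proof.
have H := growth_eventually X X_iid X_pos X_neg 1 ltr01.
apply: filterS H => w [K hK] u u0.
pose k := maxn K (Num.truncn (- ln u)).
exists (3 * psi (k.+1%:R * 1)); apply: growth_le (hK k (leq_maxl _ _)).
rewrite mulr1 -[leRHS](@lnK _ u) ?posrE // ler_expR lerNl.
by apply: le_trans (ltW (truncnS_gt _)) _; rewrite ler_nat ltnS leq_maxr.
Qed.

(** The partial sums coincide once all X_i are signs, so the equality covers every sigma, including
    those where [limn] has its default value. *)
Lemma ae_dirichlet : {ae P, forall w, forall sigma,
  random_dirichlet X sigma w = dlim (sg w) (sigma - 2^-1)}.
Proof.
apply: filterS ae_sign => w h s; rewrite /random_dirichlet /dlim; congr (limn _).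
apply/funext => n; rewrite /series /dsum /=; apply: eq_bigr => i _.
by rewrite h addrC subrK npow_powR.
Qed.

Lemma integral_sq_sum (a : nat -> R) n :
  (\int[P]_w ((\sum_(0 <= i < n) a i * rsgn X i w) ^+ 2)%:E =
   (\sum_(0 <= i < n) a i ^+ 2)%:E)%E.
Proof.
have h := integral_signs X X_iid X_pos X_neg n (fun s => (0 + wsum a 0 s) ^+ 2) (fun s => sqr_ge0 _).
rewrite avg_sq_wsum expr0n add0r in h; rewrite -h; apply: eq_integral => w _.
by rewrite wsum_signs add0r.
Qed.

Lemma measurable_sum_rsgn (a : nat -> R) n :
  measurable_fun setT (fun w => \sum_(0 <= i < n) a i * rsgn X i w).
Proof.
apply: measurable_sum => i; apply: measurable_funM => //; exact: measurable_rsgn.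
Qed.

Lemma measurable_random_dirichlet sigma :
  measurable_fun setT (random_dirichlet X sigma).
Proof.
apply: (measurable_limn (fun n w => series (fun k => X k w / k.+1%:R `^ sigma) n)) => n.
by apply: measurable_sum => i; apply: measurable_funM.
Qed.

(* Fatou bounds E F^2 above, and also E (F - F_N)^2; the lower bound follows from
   F_N^2 <= (1 + e) F^2 + (1 + 1/e) (F - F_N)^2. *)
Lemma second_moment_bounds u : 0 < u ->
  (2 * u)^-1 <= second_moment X (2^-1 + u) <= 1 + (2 * u)^-1.
Proof.
move=> u0.
have u20 : 0 < 2 * u by rewrite mulr_gt0.
pose a i := npow (2^-1 + u) i; pose F := random_dirichlet X (2^-1 + u).
pose Fn n w := \sum_(0 <= i < n) a i * rsgn X i w.
have mF : measurable_fun setT F by exact: measurable_random_dirichlet.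
have mFn n : measurable_fun setT (Fn n) by exact: measurable_sum_rsgn.
have a2 i : a i ^+ 2 = npow (1 + 2 * u) i by exact: npow_half_sq2.
have cF : {ae P, forall w, Fn ^~ w @ \oo --> F w}.
  apply: filterS2 ae_dirichlet ae_growth => w hw gw.
  rewrite /F hw addrC addKr.
  have [B gB] := gw u u0; have := dsum_cvg (sg w) B u u0 gB.
  rewrite (_ : (Fn ^~ w) = dsum (sg w) u) //.
  by apply/funext => n; apply: eq_bigr => i _; rewrite mulrC.
have EF : second_moment X (2^-1 + u) = fine (\int[P]_w (F w ^+ 2)%:E)%E.
  by rewrite /second_moment unlock.
have up : (\int[P]_w (F w ^+ 2)%:E <= (1 + (2 * u)^-1)%:E)%E.
  apply: (@fatou_bound _ _ _ P (fun n w => Fn n w ^+ 2) _ _ 0) => //.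
  - by move=> n; apply: measurable_funX.
  - by apply: measurable_funX.
  - by move=> n w; exact: sqr_ge0.
  - by move=> w; exact: sqr_ge0.
  - by apply: filterS cF => w h; apply: (cvgM h h).
  - move=> n _; rewrite integral_sq_sum lee_fin; under eq_bigr do rewrite a2.
    exact: sum_npow_le.
have ge0F : (0 <= \int[P]_w (F w ^+ 2)%:E)%E.
  by apply: integral_ge0 => w _; rewrite lee_fin sqr_ge0.
(* [fine] sends +oo to 0, so finiteness must be known before the bounds can be transferred to
   [second_moment]. *)
have finF : (\int[P]_w (F w ^+ 2)%:E)%E \is a fin_num.
  by rewrite ge0_fin_numE //; apply: le_lt_trans up _; exact: ltry.
rewrite EF; apply/andP; split; last by rewrite -lee_fin fineK.
set E := fine _.
have E0 : 0 <= E by exact: fine_ge0.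
have tail N : (\int[P]_w ((F w - Fn N.+1 w) ^+ 2)%:E <= (npow (2 * u) N / (2 * u))%:E)%E.
  apply: (@fatou_bound _ _ _ P (fun n w => (Fn n w - Fn N.+1 w) ^+ 2) _ _ N.+1) => //.
  - by move=> n; apply: measurable_funX; exact: measurable_funB.
  - by apply: measurable_funX; exact: measurable_funB.
  - by move=> n w; exact: sqr_ge0.
  - by move=> w; exact: sqr_ge0.
  - apply: filterS cF => w h.
    have h' : (fun n => Fn n w - Fn N.+1 w) @ \oo --> F w - Fn N.+1 w.
      by apply: cvgB => //; exact: cvg_cst.
    exact: (cvgM h' h').
  (* The difference F_n - F_(N+1) is rewritten as a full sum with the first coefficients set to 0,
     the form of [integral_sq_sum]. *)
  - move=> n Nn; pose b i := if (N.+1 <= i)%N then a i else 0.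
    have -> : (\int[P]_w ((Fn n w - Fn N.+1 w) ^+ 2)%:E =
      \int[P]_w ((\sum_(0 <= i < n) b i * rsgn X i w) ^+ 2)%:E)%E.
      apply: eq_integral => w _; congr ((_ ^+ 2)%:E).
      rewrite /Fn !(@big_cat_nat _ _ _ N.+1 0 n) //= addrAC subrr add0r.
      rewrite [X in _ = X + _]big_nat [X in _ = X + _]big1 ?add0r; last first.
        by move=> i /andP[_ iN]; rewrite /b leqNgt iN /= mul0r.
      by rewrite !big_nat; apply: eq_bigr => i /andP[iN _]; rewrite /b iN.
    rewrite integral_sq_sum lee_fin (@big_cat_nat _ _ _ N.+1) //= big_nat big1 ?add0r; last first.
      by move=> i /andP[_ iN]; rewrite /b leqNgt iN /= expr0n.
    rewrite (@eq_big_nat _ _ _ _ _ _ (fun i => npow (1 + 2 * u) i)); last first.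
      by move=> i /andP[iN _]; rewrite /b iN a2.
    exact: sum_npow_ub.
have key (e : R) N : 0 < e ->
    (1 - npow (2 * u) N.+1) / (2 * u) <= (1 + e) * E + (1 + e^-1) * (npow (2 * u) N / (2 * u)).
  move=> e0.
  have e1 : 0 <= 1 + e by rewrite addr_ge0 // ltW.
  have e2 : 0 <= 1 + e^-1 by rewrite addr_ge0 // invr_ge0 ltW.
  have h1 : (1 - npow (2 * u) N.+1) / (2 * u) <= \sum_(0 <= i < N.+1) a i ^+ 2.
    rewrite ler_pdivrMr // [leRHS]mulrC; under eq_bigr do rewrite a2.
    by have := sum_npow_lb _ 0 N.+1 (ltW u20) (leq0n _); rewrite npow_at0.
  apply: le_trans h1 _; rewrite -lee_fin -integral_sq_sum.
  have mf1 : measurable_fun setT (fun w => (F w ^+ 2)%:E).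
    by apply/measurable_EFinP; apply: measurable_funX.
  have mf2 : measurable_fun setT (fun w => ((F w - Fn N.+1 w) ^+ 2)%:E).
    by apply/measurable_EFinP; apply: measurable_funX; exact: measurable_funB.
  apply: (@le_trans _ _ (\int[P]_w ((1 + e)%:E * (F w ^+ 2)%:E + (1 + e^-1)%:E * ((F w - Fn N.+1 w) ^+ 2)%:E))%E).
    apply: ge0_le_integral => //.
    - by move=> w _; rewrite lee_fin sqr_ge0.
    - by apply/measurable_EFinP; apply: measurable_funX; exact: mFn.
    - by apply: emeasurable_funD; apply: measurable_funeM.
    - move=> w _; rewrite -!EFinM -EFinD lee_fin -/(Fn N.+1 w).
      (* Here q^2 = p^2 - 2p(p - q) + (p - q)^2, and the square below bounds the cross term by e p^2
         + (p - q)^2/e. *)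
      move: (F w) (Fn N.+1 w) => p q.
      have : 0 <= (e * p + (p - q)) ^+ 2 / e by rewrite divr_ge0 ?sqr_ge0 // ltW.
      have -> : (e * p + (p - q)) ^+ 2 / e = e * p ^+ 2 + 2 * p * (p - q) + e^-1 * (p - q) ^+ 2.
        by field; rewrite gt_eqF.
      lra.
  rewrite ge0_integralD //; last 4 first.
  - by move=> w _; rewrite mule_ge0 // lee_fin // sqr_ge0.
  - exact: measurable_funeM.
  - by move=> w _; rewrite mule_ge0 // lee_fin // sqr_ge0.
  - exact: measurable_funeM.
  rewrite !ge0_integralZl_EFin //; last 2 first.
  - by move=> w _; rewrite lee_fin sqr_ge0.
  - by move=> w _; rewrite lee_fin sqr_ge0.
  have -> : ((1 + e) * E + (1 + e^-1) * (npow (2 * u) N / (2 * u)))%:E =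
    ((1 + e)%:E * E%:E + (1 + e^-1)%:E * (npow (2 * u) N / (2 * u))%:E)%E by [].
  apply: leeD.
    by rewrite fineK.
  apply: lee_wpmul2l; first by rewrite lee_fin.
  exact: tail.
have key2 (e : R) : 0 < e -> (2 * u)^-1 <= (1 + e) * E.
  move=> e0; apply/ler_addgt0Pr => z z0.
  pose C := (2 + e^-1) / (2 * u).
  have C0 : 0 < C by rewrite divr_gt0 // addr_gt0 // invr_gt0.
  have [N hN] := npow_small (2 * u) (z / C) u20 ltac:(by rewrite divr_gt0).
  have := hN N (leqnn N); rewrite ltr_pdivlMr // => h1.
  have h2 := key e N e0.
  have h3 : npow (2 * u) N.+1 <= npow (2 * u) N by rewrite npow_anti // ltW.
  have : npow (2 * u) N.+1 / (2 * u) <= npow (2 * u) N / (2 * u) by rewrite ler_pM2r ?invr_gt0.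
  have e3 : npow (2 * u) N * C = npow (2 * u) N / (2 * u) + (1 + e^-1) * (npow (2 * u) N / (2 * u)).
    by rewrite /C; ring.
  move: h2 h1; rewrite e3 mulrBl mul1r; lra.
apply/ler_addgt0Pr => z z0.
have := key2 (z / (E + 1)) ltac:(by rewrite divr_gt0 // ltr_wpDl).
move=> h; apply: le_trans h _; rewrite mulrDl mul1r lerD2l.
rewrite mulrAC ler_pdivrMr ?ltr_wpDl // ler_pM2l //.
by rewrite lerDl.
Qed.

End second_moment.

(** * The law of the iterated logarithm *)

Section normalization.
Context {R : realType}.
Implicit Types (u y e c V : R).

Definition lil_norm V : R := Num.sqrt (2 * V * ln (ln V)).

Lemma ln2_le1 : ln 2 <= 1 :> R.
Proof. by have := @le_ln1Dx R 1; rewrite -[1 + 1]/(2 : R); apply; lra. Qed.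

(** V >= exp(y)/2 gives ln V >= y - ln 2 >= y/2, and then ln (ln V) >= ln y - ln 2 >= (1 - e) ln y
    since e ln y >= 1. Only u <= exp(-y) is assumed, so that u may lie between two scales. *)
Lemma norm_lb u y e V : 0 < u -> 0 < e -> e < 1 -> 2 <= y -> e^-1 <= ln y ->
  u <= expR (- y) -> (2 * u)^-1 <= V -> (1 - e) * psi y <= lil_norm V.
Proof.
move=> u0 e0 e1 y2 ly uy uV.
have l0 : 0 < ln y by apply: ln_gt0; lra.
have uV2 : expR y / 2 <= V.
  apply: le_trans uV; rewrite invfM mulrC ler_pM2l ?invr_gt0 //.
  by rewrite -[expR y]invrK -expRN lef_pV2 // posrE // expR_gt0.
have V0 : 0 < V by apply: lt_le_trans uV2; rewrite divr_gt0 ?expR_gt0.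
have lV : y / 2 <= ln V.
  apply: (@le_trans _ _ (ln (expR y / 2))); last by rewrite ler_ln // posrE divr_gt0 ?expR_gt0.
  by rewrite ln_div ?posrE ?expR_gt0 // expRK; have := ln2_le1; lra.
have llV : (1 - e) * ln y <= ln (ln V).
  have y20 : 0 < y / 2 by lra.
  apply: (@le_trans _ _ (ln (y / 2))); last by rewrite ler_ln // posrE //; exact: lt_le_trans lV.
  rewrite ln_div ?posrE //; last by lra.
  have := ln2_le1; have : 1 <= e * ln y by rewrite mulrC -ler_pdivrMr // div1r.
  lra.
have -> : (1 - e) * psi y = Num.sqrt ((1 - e) ^+ 2 * (expR y * ln y)).
  by rewrite sqrtrM ?sqr_ge0 // sqrtr_sqr ger0_norm //; lra.
rewrite ler_wsqrtr //.
have e2 : 0 <= 1 - e by lra.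
apply: (@le_trans _ _ (expR y * ((1 - e) * ln y))).
  have -> : (1 - e) ^+ 2 * (expR y * ln y) = (1 - e) * (expR y * ((1 - e) * ln y)) by ring.
  rewrite ler_piMl //; last by lra.
  by rewrite mulr_ge0 ?expR_ge0 // mulr_ge0 // ltW.
have q1 : 0 <= (1 - e) * ln y by rewrite mulr_ge0 // ltW.
have q2 : expR y <= 2 * V by lra.
by have q3 := expR_ge0 y; exact: ler_pM.
Qed.

Lemma norm_ub y e V : 2 <= y -> 2 * expR (- y) <= e -> e < 1 ->
  (2 * expR (- y))^-1 <= V <= 1 + (2 * expR (- y))^-1 -> lil_norm V <= (1 + e) * psi y.
Proof.
move=> y2 ue e1 /andP[V1 V2].
set u := expR (- y) in ue V1 V2 *.
have u0 : 0 < u by exact: expR_gt0.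
have eyE : expR y = u^-1 by rewrite /u expRN invrK.
have ey3 : 3 <= expR y by have := expR_ge1Dx y; lra.
have l0 : 0 < ln y by apply: ln_gt0; lra.
have V1' : expR y / 2 <= V by rewrite eyE -invfM mulrC.
have V2' : V <= (1 + e) * expR y / 2.
  apply: le_trans V2 _; rewrite eyE invfM.
  have : 1 <= e * u^-1 / 2.
    have : 2 * u / u <= e / u by rewrite ler_pM2r ?invr_gt0.
    rewrite mulfK ?gt_eqF //; lra.
  by lra.
have V0 : 1 < V by lra.
have lV0 : 0 < ln V by exact: ln_gt0.
have lVy : ln V <= y.
  rewrite -[leRHS]expRK ler_ln ?posrE ?expR_gt0 //; last by lra.
  have : e * expR y <= expR y by rewrite ler_piMl ?expR_ge0 // ltW.
  lra.
have llV : ln (ln V) <= ln y by rewrite ler_ln // posrE //; lra.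
have e0 : 0 < e by apply: lt_le_trans ue; rewrite mulr_gt0.
have -> : (1 + e) * psi y = Num.sqrt ((1 + e) ^+ 2 * (expR y * ln y)).
  by rewrite sqrtrM ?sqr_ge0 // sqrtr_sqr ger0_norm //; lra.
rewrite ler_wsqrtr //.
apply: (@le_trans _ _ (2 * V * ln y)).
  by rewrite ler_wpM2l //; lra.
apply: (@le_trans _ _ ((1 + e) * expR y * ln y)).
  by rewrite ler_pM2r //; lra.
rewrite -mulrA expr2 -mulrA ler_pM2l; last by lra.
by rewrite ler_peMl ?mulr_ge0 ?expR_ge0 ?(ltW l0) //; lra.
Qed.

Lemma expR_le_inv c : c < 1 -> expR c <= (1 - c)^-1.
Proof.
move=> c1; rewrite -[leLHS]invrK -expRN lef_pV2 ?posrE ?expR_gt0 ?subr_gt0 //.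
by have := expR_ge1Dx (- c); lra.
Qed.

Lemma expR_le12 c : 0 <= c -> c <= 2^-1 -> expR c <= 1 + 2 * c.
Proof.
move=> c0 c2; apply: (le_trans (expR_le_inv c _)); first by lra.
by rewrite -div1r ler_pdivrMr; [have := sqr_ge0 c; nra | lra].
Qed.

(** Between two scales the available growth bound is that of the finer one; this converts it to the
    coarser psi. *)
Lemma psi_step y c : 2 <= y -> 0 < c -> c <= 2^-1 -> psi (y + c) <= 3 * psi y.
Proof.
move=> y2 c0 c1.
have l0 : 0 < ln y by apply: ln_gt0; lra.
have -> : 3 * psi y = Num.sqrt (3 ^+ 2 * (expR y * ln y)).
  by rewrite sqrtrM ?sqr_ge0 // sqrtr_sqr ger0_norm.
rewrite ler_wsqrtr // expRD.
have ec : expR c <= 3 by have := expR_le12 c (ltW c0) c1; lra.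
have lc : ln (y + c) <= 3 * ln y.
  have -> : 3 * ln y = ln (y ^+ 3) by rewrite lnXn ?mulr_natl //; lra.
  have y0 : 0 < y by lra.
  rewrite ler_ln ?posrE ?exprn_gt0 //; last by lra.
  have y4 : 2 * 2 <= y ^+ 2 by rewrite expr2; apply: ler_pM.
  have : y * (2 * 2) <= y ^+ 3 by rewrite exprS ler_pM2l.
  lra.
have lc0 : 0 <= ln (y + c) by apply: ln_ge0; lra.
have h : expR c * ln (y + c) <= 3 * (3 * ln y) by apply: ler_pM => //; exact: expR_ge0.
have -> : expR y * expR c * ln (y + c) = expR y * (expR c * ln (y + c)) by ring.
have -> : 3 ^+ 2 * (expR y * ln y) = expR y * (3 * (3 * ln y)) by ring.
by rewrite ler_wpM2l // expR_ge0.
Qed.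

End normalization.

(** * Upper and lower bounds for the normalized series near the critical point *)

Section limsup_bounds.
Context {R : realType} {d : measure_display} {T : measurableType d}.
Context {P : probability T R} (X : nat -> {RV P >-> R}).
Hypothesis X_iid : iid X.
Hypothesis X_pos : P [set w | X 0%N w = 1] = (2^-1)%:E.
Hypothesis X_neg : P [set w | X 0%N w = - 1] = (2^-1)%:E.

Notation sg w := (fun i => rsgn X i w).
Notation Nm u := (lil_norm (second_moment X (2^-1 + u))).

Lemma dlim_upper (e : R) : 0 < e -> e < 4^-1 ->
  {ae P, forall w, exists2 u0, 0 < u0 & forall u, 0 < u < u0 ->
    dlim (sg w) u <= (1 + 8 * e) * Nm u}.
Proof.
(* Between neighbouring scales the oscillation is at most 16 times 9 psi times 2c, that is 288 c
   psi; this choice of c keeps it below e psi. *)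
move=> e0 e4; pose c := e / 300.
have c0 : 0 < c by rewrite /c; lra.
have c1 : c <= 2^-1 by rewrite /c; lra.
have H1 := growth_eventually X X_iid X_pos X_neg c c0.
have H2 := dsum_eventually X X_iid X_pos X_neg c e c0 e0.
apply: filterS2 H1 H2 => w [K1 h1] [K2 h2].
pose Y := expR e^-1 + 2 / e + 2.
pose K := maxn (maxn K1 K2) (Num.truncn (Y / c)).
exists (expR (- (K.+1%:R * c))); first exact: expR_gt0.
move=> u /andP[u0 uK].
pose z := - ln u.
have uE : u = expR (- z) by rewrite /z opprK lnK.
have zK : K.+1%:R * c < z by move: uK; rewrite {1}uE ltr_expR ltrN2.
have z0 : 0 <= z / c by rewrite divr_ge0 ?(ltW c0) //; apply: le_trans (ltW zK); rewrite mulr_ge0 // ltW.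
have [m1 m2] := andP (truncn_itv z0).
set m := Num.truncn _ in m1 m2.
have mK : (K < m)%N.
  have : K.+1%:R < m.+1%:R :> R by apply: lt_trans m2; rewrite ltr_pdivlMr.
  by rewrite ltr_nat ltnS.
case: m m1 m2 mK => [//|k]; rewrite ltnS => m1 m2 Kk.
pose y := k.+1%:R * c; pose v := expR (- y).
have yz : y <= z by rewrite /y -ler_pdivlMr.
have yz2 : z <= y + c.
  by have := ltW m2; rewrite ler_pdivrMr // /y -[k.+2]addn1 natrD mulrDl mul1r.
have yc : k.+2%:R * c = y + c by rewrite /y -[k.+2]addn1 natrD mulrDl mul1r.
have [[Kk1 Kk2] KkY] : ((K1 <= k)%N /\ (K2 <= k)%N) /\ (Num.truncn (Y / c) <= k)%N.
  by move: Kk; rewrite /K !geq_max => /andP[/andP[-> ->] ->].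
have yY : Y <= y.
  rewrite /y -ler_pdivrMr //; apply: le_trans (ltW (truncnS_gt _)) _.
  by rewrite ler_nat ltnS.
have ei0 : 0 < 2 / e by rewrite divr_gt0.
have y2 : 2 <= y by apply: le_trans yY; rewrite /Y; have := expR_gt0 e^-1; lra.
have ly : e^-1 <= ln y.
  rewrite -ler_expR lnK ?posrE; last by lra.
  by apply: le_trans yY; rewrite /Y; lra.
have ve : 2 * v <= e.
  rewrite /v expRN ler_pdivrMr ?expR_gt0 // mulrC -ler_pdivrMr //.
  apply: le_trans (expR_ge1Dx _).
  by have := expR_gt0 e^-1; move: yY; rewrite /Y; lra.
have v0 : 0 < v by exact: expR_gt0.
have uv : u <= v by rewrite uE ler_expR lerN2.
have u1 : u <= 1 by lra.
have p0 := psi_ge0 y.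
(* Growth bounds pass to larger u, so the scale exp(-(y + c)) just below u is used. *)
have gu : growth (sg w) (3 * psi (y + c)) u.
  have := h1 k.+1 (leqW Kk1); rewrite yc; apply: growth_le.
  by rewrite [leRHS]uE ler_expR lerN2.
have gv : growth (sg w) (3 * psi y) v by exact: h1 k Kk1.
have osc := dlim_osc (sg w) _ u v u0 gu u1 uv.
have vu : (v - u) / u <= 2 * c.
  have : v <= expR c * u.
    by rewrite {1}uE -expRD ler_expR; lra.
  have := expR_le12 c (ltW c0) c1 => ec h.
  rewrite ler_pdivrMr //.
  have : expR c * u <= (1 + 2 * c) * u by rewrite ler_pM2r.
  lra.
have dv : dlim (sg w) v <= (1 + e) * psi y.
  apply: (@le_trans _ _ (Num.sqrt (2 * ((1 + e) * ln y) * (1 + (2 * v)^-1)))).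
    apply: limr_le; first exact: (dsum_cvg (sg w) _ v v0 gv).
    by apply: nearW => n; exact: h2 k Kk2 n.
  have l0 : 0 < ln y by apply: ln_gt0; lra.
  have -> : (1 + e) * psi y = Num.sqrt ((1 + e) ^+ 2 * (expR y * ln y)).
    by rewrite sqrtrM ?sqr_ge0 // sqrtr_sqr ger0_norm //; lra.
  rewrite ler_wsqrtr //.
  have eyE : expR y = v^-1 by rewrite /v expRN invrK.
  have -> : 2 * ((1 + e) * ln y) * (1 + (2 * v)^-1) = (1 + e) * (ln y * v^-1 * (1 + 2 * v)).
    by field; rewrite gt_eqF.
  have -> : (1 + e) ^+ 2 * (expR y * ln y) = (1 + e) * (ln y * v^-1 * (1 + e)) by rewrite eyE; ring.
  rewrite ler_pM2l; last by lra.
  by rewrite ler_pM2l ?mulr_gt0 ?invr_gt0 //; lra.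
have ps := psi_step y c y2 c0 c1.
have osc2 : dlim (sg w) u - dlim (sg w) v <= e * psi y.
  apply: le_trans (ler_norm _) _; apply: le_trans osc _.
  apply: (@le_trans _ _ (16 * (3 * (3 * psi y)) * (2 * c))).
    apply: ler_pM => //.
    - by rewrite mulr_ge0 // mulr_ge0 // psi_ge0.
    - by rewrite divr_ge0 ?subr_ge0 // ltW.
    - by rewrite ler_pM2l // ler_pM2l.
  have ep : 0 <= e * psi y by rewrite mulr_ge0 // ltW.
  rewrite /c; lra.
have /andP[sm _] := second_moment_bounds X X_iid X_pos X_neg u u0.
have nb := norm_lb u y e (second_moment X (2^-1 + u)) u0 e0 ltac:(lra) y2 ly ltac:(by rewrite -/v) sm.
have N0 : 0 <= Nm u by exact: sqrtr_ge0.
have : (1 + 2 * e) * psi y <= (1 + 8 * e) * Nm u.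
  apply: (@le_trans _ _ ((1 + 8 * e) * ((1 - e) * psi y))); last by rewrite ler_wpM2l //; lra.
  rewrite mulrA ler_wpM2r //.
  have : e * e <= e * 4^-1 by rewrite ler_pM2l // ltW.
  lra.
lra.
Qed.

Lemma dlim_lower (dl : R) : 0 < dl -> dl < 8^-1 ->
  {ae P, forall w, forall u0, 0 < u0 -> exists u, [/\ 0 < u < u0, 0 < Nm u &
    (1 - 8 * dl) * Nm u <= dlim (sg w) u]}.
Proof.
move=> dl0 dl8.
(* L = 4 l turns the growth factor n^(u/4) at the end of a block into 2^l. The tail is then at most
   12 psi/2^l, small for l near 36/dl. The head is at most 3 2^l psi/sqrt q, whence the squared term
   of A; the other term of A serves the variance condition of [blocks_io]. *)
pose l := Num.truncn (36 / dl); pose L := (4 * l)%N.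
pose A := 8 * L%:R / dl + (3 * 2 ^+ l / dl) ^+ 2.
pose q := (Num.truncn A).+2.
have l36 : 36 / dl <= l.+1%:R by exact: ltW (truncnS_gt _).
have qA : A <= q%:R.
  by apply: le_trans (ltW (truncnS_gt _)) _; rewrite ler_nat.
have q1 : (1 < q)%N by [].
have q0 : 0 < q%:R :> R by rewrite ltr0n.
have cond : 2 * L%:R / q%:R + L.+1%:R^-1 <= dl / 2.
  have h1 : 2 * L%:R / q%:R <= dl / 4.
    have : 8 * L%:R / dl <= q%:R by apply: le_trans qA; rewrite /A lerDl sqr_ge0.
    by rewrite ler_pdivrMr // => h; rewrite ler_pdivrMr //; lra.
  have h2 : L.+1%:R^-1 <= dl / 4.
    rewrite -[leRHS]invrK lef_pV2 ?posrE ?invr_gt0 ?divr_gt0 ?ltr0n // invf_div.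
    apply: (@le_trans _ _ (36 / dl)); first by rewrite ler_pM2r ?invr_gt0 //; lra.
    apply: le_trans l36 _; rewrite ler_nat ltnS /L; exact: leq_pmull.
  by apply: le_trans (lerD h1 h2) _; lra.
pose c : R := ln q%:R.
have c0 : 0 < c by apply: ln_gt0; rewrite ltr1n.
have H1 := growth_eventually X X_iid X_pos X_neg c c0.
have H2 := blocks_io X X_iid X_pos X_neg dl L q dl0 dl8 q1 cond.
apply: filterS2 H1 H2 => w [K1 h1] h2 u0 u00.
pose Y := expR dl^-1 + 2 / dl + 2 + `|ln u0|.
(* The successor makes the block index positive, so that a preceding scale exists for the head of
   the series. *)
have [[//|k] /= Kk blk] := h2 (maxn K1 (Num.truncn (Y / c))).+1.
move: Kk; rewrite ltnS geq_max => /andP[Kk1 Kk2].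
rewrite -/c in blk.
set y := k.+2%:R * c in blk; set u := expR (- y) in blk.
have yY : Y <= y.
  rewrite /y -ler_pdivrMr //; apply: le_trans (ltW (truncnS_gt _)) _.
  by rewrite ler_nat ltnS leqW.
have di0 : 0 < 2 / dl by rewrite divr_gt0.
have ed0 := expR_gt0 dl^-1.
have nl0 := normr_ge0 (ln u0).
have y2 : 2 <= y by apply: le_trans yY; rewrite /Y; lra.
have ly : dl^-1 <= ln y.
  rewrite -ler_expR lnK ?posrE; last by lra.
  by apply: le_trans yY; rewrite /Y; lra.
have u_gt0 : 0 < u by exact: expR_gt0.
have ud : 2 * u <= dl.
  rewrite /u expRN ler_pdivrMr ?expR_gt0 // mulrC -ler_pdivrMr //.
  apply: le_trans (expR_ge1Dx _).
  by move: yY; rewrite /Y; lra.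
have uu0 : u < u0.
  rewrite /u -[ltRHS](@lnK _ u0) ?posrE // ltr_expR ltrNl.
  have := ler_norm (- ln u0); rewrite normrN.
  by move: yY; rewrite /Y; lra.
have sm := second_moment_bounds X X_iid X_pos X_neg u u_gt0.
have /andP[sm1 _] := sm.
have nlb := norm_lb u y dl (second_moment X (2^-1 + u)) u_gt0 dl0 ltac:(lra) y2 ly (lexx _) sm1.
have nub := norm_ub y dl (second_moment X (2^-1 + u)) y2 ud ltac:(lra) sm.
have l_gt0 : 0 < ln y by apply: ln_gt0; lra.
have psi0 : 0 < psi y by rewrite sqrtr_gt0 mulr_gt0 ?expR_gt0.
exists u; split.
- by rewrite u_gt0.
- by apply: lt_le_trans nlb; rewrite mulr_gt0 //; lra.
(* The block gives 1 - 5 dl, and the head and the tail lose dl each; then (1 - 8 dl)(1 + dl) <= 1 -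
   7 dl accounts for the normalization. *)
suff main : (1 - 7 * dl) * psi y <= dlim (sg w) u.
  apply: le_trans main.
  apply: (@le_trans _ _ ((1 - 8 * dl) * ((1 + dl) * psi y))); first by rewrite ler_wpM2l //; lra.
  rewrite mulrA ler_pM2r //; have := sqr_ge0 dl; lra.
pose M k := (2 ^ (L * q ^ k))%N.
have M0 i : (0 < M i)%N by rewrite expn_gt0.
have lnME i : ln (M i)%:R = L%:R * q%:R ^+ i * ln 2 :> R.
  by rewrite /M natrX lnXn // -[_ *+ (L * q ^ i)]mulr_natl natrM natrX.
have expc i : expR (- (i.+1%:R * c)) = (q%:R ^+ i.+1)^-1.
  by rewrite expRN mulrC expRM_natr lnK ?posrE.
have LE : L%:R = 4 * l%:R :> R by rewrite /L natrM.
have ln20 : 0 <= ln 2 :> R by apply: ln_ge0; lra.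
have uM i : expR (- (i.+1%:R * c)) * ln (M i.+1)%:R = 4 * (l%:R * ln 2).
  by rewrite expc lnME LE; field; rewrite expf_neq0 // gt_eqF.
pose u' := expR (- (k.+1%:R * c)).
have uu' : u <= u' by rewrite ler_expR lerN2 ler_pM2r // ler_nat.
have g' : growth (sg w) (3 * psi (k.+1%:R * c)) u' by exact: h1 k Kk1.
have g : growth (sg w) (3 * psi y) u by apply: h1; exact: leqW.
have two_l : expR (l%:R * ln 2) = 2 ^+ l :> R by rewrite mulrC expRM_natr lnK ?posrE.
have l12 : 12 * (2 ^+ l)^-1 <= dl :> R.
  rewrite ler_pdivrMr ?exprn_gt0 // mulrC -ler_pdivrMr //.
  apply: (@le_trans _ _ (36 / dl)); first by rewrite ler_pM2r ?invr_gt0 //; lra.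
  apply: le_trans l36 _; rewrite -natrX ler_nat; exact: ltn_expl.
have tailb : `|dlim (sg w) u - dsum (sg w) u (M k.+2)| <= dl * psi y.
  have := dlim_tail (sg w) _ u u_gt0 g (M k.+2).-1; rewrite prednK //.
  move=> h; apply: le_trans h _.
  have -> : npow (3 / 4 * u) (M k.+2).-1 = expR (- (3 * (l%:R * ln 2))).
    rewrite /npow prednK //; congr expR.
    have := uM k.+1; rewrite -/y -/u => h.
    transitivity (- (3 / 4 * (u * ln (M k.+2)%:R))); first by ring.
    by rewrite h; field.
  have h3 : expR (- (3 * (l%:R * ln 2))) <= (2 ^+ l)^-1 :> R.
    by rewrite -two_l -expRN ler_expR lerN2 ler_peMl ?mulr_ge0 //; lra.
  apply: (@le_trans _ _ (4 * (3 * psi y) * (2 ^+ l)^-1)).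
    by rewrite ler_wpM2l // mulr_ge0 // mulr_ge0 // ltW.
  have -> : 4 * (3 * psi y) * (2 ^+ l)^-1 = 12 * (2 ^+ l)^-1 * psi y by ring.
  by rewrite ler_pM2r.
have y1c : 0 < k.+1%:R * c by rewrite mulr_gt0 // ltr0n.
have psi' : psi (k.+1%:R * c) * Num.sqrt q%:R <= psi y.
  rewrite mulrC -sqrtrM ?(ltW q0) //.
  have yS : y = k.+1%:R * c + c by rewrite /y -[k.+2]addn1 natrD mulrDl mul1r.
  have ec : expR c = q%:R by rewrite lnK ?posrE.
  rewrite /psi ler_wsqrtr // yS expRD ec.
  rewrite mulrA [q%:R * _]mulrC ler_wpM2l ?mulr_ge0 ?expR_ge0 ?(ltW q0) // ler_ln ?posrE //.
    by rewrite lerDl ltW.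
  by rewrite addr_gt0.
have sq : 3 * 2 ^+ l / dl <= Num.sqrt q%:R.
  rewrite -[leLHS]ger0_norm; last by rewrite divr_ge0 ?(ltW dl0) // mulr_ge0 // exprn_ge0.
  rewrite -sqrtr_sqr ler_wsqrtr //; apply: le_trans qA.
  by rewrite /A lerDr divr_ge0 ?(ltW dl0) // mulr_ge0.
have initb : `|dsum (sg w) u (M k.+1)| <= dl * psi y.
  apply: (@le_trans _ _ (3 * psi (k.+1%:R * c) * 2 ^+ l)).
    apply: dsum_init => //; first exact: ltW.
      move=> j jM; apply: le_trans (g' j) _.
      apply: ler_wpM2l; first by rewrite mulr_ge0 // psi_ge0.
      rewrite /npow opprK -two_l ler_expR.
      have h : u' * ln j.+1%:R <= u' * ln (M k.+1)%:R.
        by rewrite ler_pM2l ?expR_gt0 // ler_ln ?posrE ?ltr0n // ler_nat.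
      by move: h; rewrite [X in _ <= X]uM; lra.
    by rewrite mulr_ge0 ?exprn_ge0 // mulr_ge0 // psi_ge0.
  have : psi (k.+1%:R * c) * (3 * 2 ^+ l / dl) <= psi y.
    by apply: le_trans psi'; rewrite ler_wpM2l // psi_ge0.
  rewrite mulrA ler_pdivrMr // => h; rewrite [leRHS]mulrC; apply: le_trans h.
  by rewrite le_eqVlt; apply/orP; left; apply/eqP; ring.
have split_sum : dsum (sg w) u (M k.+2) = dsum (sg w) u (M k.+1) +
    \sum_(M k.+1 <= i < M k.+2) npow (2^-1 + u) i * rsgn X i w.
  rewrite /dsum (@big_cat_nat _ _ _ (M k.+1)) //=; last by rewrite leq_exp2l // leq_mul2l leq_exp2l // leqnSn orbT.
  by congr (_ + _); apply: eq_bigr => i _; rewrite mulrC.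
move: tailb initb blk; rewrite split_sum -!/(M _).
rewrite !ler_norml => /andP[t1 _] /andP[i1 _] b1.
lra.
Qed.

End limsup_bounds.

Theorem theorem1p1 (R : realType) (d : measure_display) (T : measurableType d)
    (P : probability T R) (X : nat -> {RV P >-> R})
    (X_iid : iid X)
    (X_pos : P [set w | X 0%N w = 1] = (2^-1)%:E)
    (X_neg : P [set w | X 0%N w = - 1] = (2^-1)%:E) :
  {ae P, forall w : T,
    limf_esup
      (fun sigma : R =>
         (random_dirichlet X sigma w /
          Num.sqrt (2 * second_moment X sigma
                      * ln (ln (second_moment X sigma))))%:E)
      (2^-1 : R)^'+ = 1%E}.
Proof.
(* Countably many tolerances tending to 0 keep the union of the exceptional sets null; the factor 9
   places them below the 1/8 and 1/4 of the two bounds. *)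
pose e n : R := (n.+1 * 9)%:R^-1.
have e0 n : 0 < e n by rewrite invr_gt0 ltr0n.
have e8 n : e n < 8^-1.
  by rewrite ltf_pV2 ?posrE ?ltr0n // ltr_nat (@leq_trans 9).
have HU := ae_foralln (fun n => dlim_upper X X_iid X_pos X_neg (e n) (e0 n) ltac:(by have := e8 n; lra)).
have HL := ae_foralln (fun n => dlim_lower X X_iid X_pos X_neg (e n) (e0 n) (e8 n)).
have HD := ae_dirichlet X X_iid X_pos X_neg.
have small (z : R) : 0 < z -> exists n, 8 * e n <= z.
  move=> z0; exists (Num.truncn z^-1).
  have : (Num.truncn z^-1).+1%:R^-1 <= z.
    rewrite -[leRHS]invrK lef_pV2 ?posrE ?invr_gt0 ?ltr0n //; exact: ltW (truncnS_gt _).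
  have : 8 * e (Num.truncn z^-1) <= (Num.truncn z^-1).+1%:R^-1.
    rewrite /e natrM invfM mulrCA ler_piMr ?invr_ge0 //; lra.
  exact: le_trans.
apply: filterS3 HU HL HD => w hU hL hD.
set f := fun sigma : R => _.
apply/eqP; rewrite eq_le; apply/andP; split.
  apply/lee_addgt0Pr => z z0.
  have [n hn] := small z z0; have [u0 u00 hu] := hU n.
  apply: ge_ereal_inf.
  exists (ereal_sup (f @` [set s | 2^-1 < s < 2^-1 + u0])).
    exists [set s | 2^-1 < s < 2^-1 + u0] => //.
    near=> s; apply/andP; split; first by near: s; exact: nbhs_right_gt.
    by near: s; apply: nbhs_right_lt; rewrite ltrDl.
  apply: ge_ereal_sup => _ [s /andP[s1 s2] <-].
  rewrite /f -EFinD lee_fin hD.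
  have us : 0 < s - 2^-1 < u0 by rewrite subr_gt0 s1 ltrBlDl.
  have := hu _ us; rewrite /lil_norm (addrC 2^-1) subrK.
  set N := Num.sqrt _ => h.
  (* Division by 0 gives 0, which respects the upper bound; for the lower bound [dlim_lower]
     supplies a positive normalization. *)
  have [->|N0] := eqVneq N 0; first by rewrite invr0 mulr0 addr_ge0 // ltW.
  have Npos : 0 < N by rewrite lt_neqAle eq_sym N0 sqrtr_ge0.
  rewrite ler_pdivrMr //; apply: le_trans h _.
  by rewrite ler_pM2r // lerD2l.
apply: le_ereal_inf_tmp => _ [V FV <-].
apply/lee_subgt0Pr => z z0.
have [n hn] := small z z0.
have [r r0 hr] : exists2 r : R, 0 < r & forall s, 2^-1 < s < 2^-1 + r -> V s.
  move: FV => /nbhs_ballP[r r0 hr]; exists r => // s /andP[s1 s2].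
  apply: hr => //; rewrite /ball /= ltr_distlC; apply/andP; split => //.
  by apply: lt_trans s1; rewrite ltrBlDr ltrDl.
have [u [/andP[u0 ur] N0 hu]] := hL n r r0.
apply: le_ereal_sup_tmp; exists (f (2^-1 + u)).
  exists (2^-1 + u) => //; apply: hr.
  by rewrite ltrDl u0 ltrD2l.
rewrite /f -EFinB lee_fin hD (addrC 2^-1 u) addrK.
move: N0 hu; rewrite /lil_norm (addrC 2^-1 u); set N := Num.sqrt _ => N0 hu.
rewrite ler_pdivlMr //; apply: le_trans hu.
by rewrite ler_pM2r // lerD2l lerN2.
Unshelve. all: by end_near.
Qed.
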